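(* Let $n\ge 1$ and $1<p<\infty$. There is a constant $C$, depending only on $n$ and $p$, such that for every $f\in JN_p^+(\mathbb{R}^n)$, every cube $Q_0\subset\mathbb{R}^n$ and every $\lambda>0$, $$ \left|\left\{x\in Q_0: \left(f(x)-f_{Q_0^{+,2}}\right)^+>\lambda\right\}\right|\le C\left(\frac{K_f^+}{\lambda}\right)^p . $$
   Context: A cube in $\mathbb{R}^n$ is a set $Q=\prod_{i=1}^n[a_i,a_i+h]$ with $a_i\in\mathbb{R}$, $h>0$ (sides parallel to the coordinate axes). Its forward in time translation is $$Q^+:=\prod_{i=1}^{n-1}[a_i,a_i+h]\times[a_n+h,a_n+2h],$$ and $Q^{+,2}:=(Q^+)^+$. Cubes are called non-overlapping if their interiors are disjoint. $|E|$ denotes the Lebesgue measure of $E\subset\mathbb{R}^n$. For a real-valued locally integrable function $g$ and a measurable set $E$ which is bounded and of positive measure, $g_E=\frac{1}{|E|}\int_E g\,dx$ is the average of $g$ over $E$. For a real number (or function) $t$, $t^+=\max(t,0)$. For a real-valued locally integrable function $f$ on $\mathbb{R}^n$ and an exponent $p$, the quantity $K_f^+\in[0,\infty]$ is defined by $$ (K_f^+)^p:=\sup_{\{Q_j\}_j}\sum_j|Q_j|\left(\frac{1}{|Q_j\cup Q_j^+|}\int_{Q_j\cup Q_j^+}\left(f-f_{Q_j^{+,2}}\right)^+dx\right)^p, $$ where the supremum is taken over all countable families $\{Q_j\}_j$ of pairwise non-overlapping cubes in $\mathbb{R}^n$ with $\sum_j|Q_j|<\infty$. One writes $f\in JN_p^+(\mathbb{R}^n)$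 if $K_f^+<\infty$. *)

(* Defs.v *)
From HB Require Import structures.
From mathcomp Require Import all_boot all_order all_algebra.
From mathcomp Require Import all_classical all_reals all_analysis.

Set Implicit Arguments.
Unset Strict Implicit.
Unset Printing Implicit Defensive.

Import Order.TTheory GRing.Theory Num.Theory.
Import numFieldNormedType.Exports.

Local Open Scope classical_set_scope.
Local Open Scope ring_scope.

(* Points of R^d are row vectors; the dimension is always of the form n.+1,
   i.e. d >= 1, and the last ("time") coordinate has index [ord_max]. *)

(** Lebesgue measure on R^(n+1): Lebesgue outer measure, defined by countable
    covers with closed boxes, restricted to its Caratheodory-measurable sets,
    which are exactly the Lebesgue measurable sets. *)
Section lebesgue_measure_rV.
Context (R : realType) (n : nat).
Local Notation V := 'rV[R]_n.+1.

Definition box (ab : V * V) : set V :=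
  [set x | forall i, x ord0 i \in `[ab.1 ord0 i, ab.2 ord0 i]].

(* The truncation at 0 accounts for empty boxes. *)
Definition box_volume (ab : V * V) : R :=
  \prod_(i < n.+1) Num.max 0 (ab.2 ord0 i - ab.1 ord0 i).

Definition lebesgue_outer_rV (X : set V) : \bar R :=
  ereal_inf [set (\sum_(k <oo) (box_volume (B k))%:E)%E
            | B in [set B : nat -> V * V | X `<=` \bigcup_k box (B k)]].

Lemma box_volume_ge0 ab : 0 <= box_volume ab.
Proof. by apply: prodr_ge0 => i _; rewrite le_max lexx. Qed.

Local Open Scope ereal_scope.

Let vol_ge0 ab : 0 <= (box_volume ab)%:E.
Proof. by rewrite lee_fin box_volume_ge0. Qed.

Lemma lebesgue_outer_rV_ge0 X : 0 <= lebesgue_outer_rV X.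
Proof.
by apply: le_ereal_inf_tmp => _ [B _ <-]; apply: nneseries_ge0 => k _ _.
Qed.

Lemma lebesgue_outer_rV0 : lebesgue_outer_rV set0 = 0.
Proof.
apply/eqP; rewrite eq_le lebesgue_outer_rV_ge0 andbT.
apply: ereal_inf_lbound; exists (fun=> (0%R, 0%R)) => //=.
apply: eseries0 => k _ _; rewrite /box_volume /= (bigD1 ord0)//= !mxE.
by rewrite subrr maxxx mul0r.
Qed.

Lemma le_lebesgue_outer_rV :
  {homo lebesgue_outer_rV : A B / A `<=` B >-> A <= B}.
Proof.
move=> A B AB; apply/ereal_inf_le_tmp => _ [F BF <-].
by exists F => //=; exact: subset_trans AB BF.
Qed.

Lemma lebesgue_outer_rV_sigma_subadditive :
  sigma_subadditive lebesgue_outer_rV.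
Proof.
move=> A; have [[i ioo]|] := pselect (exists i, lebesgue_outer_rV (A i) = +oo).
  rewrite (eseries_pinfty _ _ ioo) ?leey// => k _.
  by rewrite -ltNye (lt_le_trans _ (lebesgue_outer_rV_ge0 _)).
rewrite -forallNE => Aoo.
suff add2e (e : {posnum R}) : lebesgue_outer_rV (\bigcup_k A k) <=
    \sum_(i <oo) lebesgue_outer_rV (A i) + e%:num%:E.
  by apply/lee_addgt0Pr => _/posnumP[].
rewrite (le_trans _ (epsilon_trick _ _ _))//; last first.
  by move=> k; exact: lebesgue_outer_rV_ge0.
pose P k (B : nat -> V * V) := A k `<=` \bigcup_j box (B j) /\
  \sum_(j <oo) (box_volume (B j))%:E <=
    lebesgue_outer_rV (A k) + (e%:num / (2 ^ k.+1)%:R)%:E.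
have [G PG] : {G : nat -> nat -> V * V & forall k, P k (G k)}.
  apply: (@choice _ _ P) => k.
  have Ak : lebesgue_outer_rV (A k) \is a fin_num.
    by rewrite ge0_fin_numE ?lebesgue_outer_rV_ge0// lt_neqAle leey andbT;
      apply/eqP; exact: Aoo.
  have ek : (0 < e%:num / (2 ^ k.+1)%:R :> R)%R by [].
  have [_ [B AB <-] /ltW Bk] := lb_ereal_inf_adherent ek Ak.
  by exists B; split.
pose v (ij : nat * nat) := (box_volume (G ij.1 ij.2))%:E.
have v0 ij : 0 <= v ij by exact: vol_ge0.
apply: (@le_trans _ _ (\esum_(ij in [set: nat * nat]) v ij)).
  have /card_esym/ppcard_eqP[f] := card_nat2.
  apply: ereal_inf_lbound => /=; exists (fun k => G (f k).1 (f k).2).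
    move=> x [i _ Aix]; have [j _ Gx] := (PG i).1 _ Aix.
    by exists (f^-1%FUN (i, j)) => //=; rewrite invK ?inE.
  rewrite -(esum_pred_image v f xpredT) ?[fun=> _]set_true//.
  by rewrite image_eq.
rewrite (_ : [set: nat * nat] = setT `*`` (fun=> setT)); last first.
  by apply/seteqP; split.
rewrite -(@esum_esum _ _ _ _ _ (fun i j => v (i, j)))//.
rewrite -[leLHS]nneseries_esumT; last by move=> i; exact: esum_ge0.
apply: lee_nneseries => [i _ _|i _]; first exact: esum_ge0.
by rewrite -nneseries_esumT//; exact: (PG i).2.
Qed.

HB.instance Definition _ := isOuterMeasure.Build R V lebesgue_outer_rV
  lebesgue_outer_rV0 lebesgue_outer_rV_ge0 le_lebesgue_outer_rV
  lebesgue_outer_rV_sigma_subadditive.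

(* ['rV[R]_n.+1] equipped with the Lebesgue sigma-algebra. *)
Definition lebRV := caratheodory_type lebesgue_outer_rV.

HB.instance Definition _ := Measurable.on lebRV.

Definition lebesgue_measure_rV : set lebRV -> \bar R := lebesgue_outer_rV.

HB.instance Definition _ := isMeasure.Build _ lebRV R lebesgue_measure_rV
  (caratheodory_measure0 _) (@caratheodory_measure_ge0 _ _ _)
  (@caratheodory_measure_sigma_additive _ _ _).

End lebesgue_measure_rV.

Section cubes.
Context (R : realType) (n : nat).
Local Notation V := 'rV[R]_n.+1.

Record cube := Cube { corner : V; side : R; side_gt0 : 0 < side }.

Definition cube_set (Q : cube) : set V :=
  [set x | forall i, x ord0 i \in
    `[corner Q ord0 i, corner Q ord0 i + side Q]].

Definition forward (Q : cube) : cube :=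
  Cube (corner Q + side Q *: delta_mx ord0 ord_max) (side_gt0 Q).

End cubes.

Section JNp.
Context (R : realType) (n : nat).
Local Notation V := 'rV[R]_n.+1.
Local Notation mu := (@lebesgue_measure_rV R n).
Local Notation cube := (@cube R n).

Definition locally_integrable_rV (f : V -> R) : Prop :=
  measurable_fun [set: lebRV R n] (f : lebRV R n -> R) /\
  forall K : set V, compact K -> (\int[mu]_(x in K) `|f x|%:E < +oo)%E.

Definition average (E : set V) (g : V -> R) : R :=
  (fine (mu E))^-1 * \int[mu]_(x in E) g x.

Definition osc_plus (f : V -> R) (Q : cube) : R :=
  average (cube_set Q `|` cube_set (forward Q))
    (fun x => Num.max (f x - average (cube_set (forward (forward Q))) f) 0).

Definition non_overlapping (D : set nat) (Q : nat -> cube) : Prop :=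
  trivIset D (fun j => interior (cube_set (Q j))).

Local Open Scope ereal_scope.

(* Countable families of cubes are indexed by an arbitrary set [D] of naturals,
   so that finite families are included. *)
Definition JNp_plus_sums (p : R) (f : V -> R) : set (\bar R) :=
  [set S | exists (D : set nat) (Q : nat -> cube),
    [/\ non_overlapping D Q,
        \esum_(j in D) mu (cube_set (Q j)) < +oo &
        S = \esum_(j in D) (mu (cube_set (Q j)) * (osc_plus f (Q j) `^ p)%:E)]].

Definition Kplus (p : R) (f : V -> R) : \bar R :=
  ereal_sup (JNp_plus_sums p f) `^ p^-1.

Definition JNp_plus (p : R) (f : V -> R) : Prop :=
  locally_integrable_rV f /\ Kplus p f < +oo.

End JNp.

(* Main.v *)
Require Import Defs.
From mathcomp Require Import all_boot all_order all_algebra.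
From mathcomp Require Import all_classical all_reals all_analysis.
From mathcomp Require Import measurable_realfun.
From mathcomp Require Import ring lra.

(** Fix [Q0], put [c = f_{Q0^{+,2}}] and let [E(l)] be the union of the dyadic subcubes [Q] of
    [Q0] with [f_{Q^{+,2}} > c + l].  By Lebesgue differentiation [f <= c + l] almost everywhere
    on [Q0] outside [E(l)].  Let [P] run through the maximal dyadic parents of the maximal cubes
    of [E(l)]; thus [f_{P^{+,2}} <= c + l].  If [Q] is a strictly smaller subcube of [P] then
    [Q^{+,2}] lies in the union of [P] and [P^+]; if in addition [f_{Q^{+,2}} > c + 2l], then the
    average of [(f - f_{P^{+,2}})^+] over [Q^{+,2}] exceeds [l].  Translates [Q^{+,2}] of
    dyadic cubes are again dyadic, and selecting the maximal ones costs only a factor 3, since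
    [Q^{+,2}] inside [R^{+,2}] forces [Q] into the union of [R], [R^+] and [R^{+,2}].  Hence
    [l |E(2l)| <= 6 sum_P |P| osc(P)], and [osc <= s + s^(1-p) osc^p] with [s = eta l] bounds
    this by [6 eta l 2^n |E(l)| + 6 (eta l)^(1-p) K^p].  For small [eta], the function
    [g(l) = l^p |E(l)|] satisfies [g(2l) <= g(l)/2 + C K^p]; as [g(l) <= l^p |Q0|], iterating
    towards [l = 0] gives [g <= 2 C K^p]. *)

Set Implicit Arguments.
Unset Strict Implicit.
Unset Printing Implicit Defensive.

Import Order.TTheory GRing.Theory Num.Theory.
Import numFieldNormedType.Exports.

Local Open Scope classical_set_scope.
Local Open Scope ring_scope.

(** * Lebesgue measure of boxes *)

Section box_measure.
Context (R : realType) (n : nat).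
Local Notation V := 'rV[R]_n.+1.
Local Notation mu := (@lebesgue_measure_rV R n).

Definition update_coord (x : V) (j : 'I_n.+1) (t : R) : V :=
  \row_i (if i == j then t else x ord0 i).

(* The indicator of a box, with the coordinates [i < j] integrated out. *)
Definition partial_volume (j : nat) (ab : V * V) (x : V) : R :=
  \prod_(i < n.+1) (if (i < j)%N then Num.max 0 (ab.2 ord0 i - ab.1 ord0 i)
                    else \1_(`[ab.1 ord0 i, ab.2 ord0 i]%classic) (x ord0 i)).

Lemma partial_volume_ge0 j ab x : 0 <= partial_volume j ab x.
Proof.
apply: prodr_ge0 => i _; case: ifP => _; first by rewrite le_max lexx.
by rewrite indicE.
Qed.

Lemma lebesgue_measure_segment (a b : R) :
  lebesgue_measure `[a, b]%classic = (Num.max 0 (b - a))%:E.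
Proof.
rewrite lebesgue_measure_itv /= lte_fin; case: ltP => ab.
  by rewrite -EFinD; congr EFin; apply/esym/max_idPr; rewrite subr_ge0 ltW.
by congr EFin; apply/esym/max_idPl; rewrite subr_le0.
Qed.

Lemma partial_volume_update (j : 'I_n.+1) ab x t : partial_volume j ab (update_coord x j t) =
  (\prod_(i < n.+1 | i != j)
     (if (i < j)%N then Num.max 0 (ab.2 ord0 i - ab.1 ord0 i)
      else \1_(`[ab.1 ord0 i, ab.2 ord0 i]%classic) (x ord0 i))) *
  \1_(`[ab.1 ord0 j, ab.2 ord0 j]%classic) t.
Proof.
rewrite /partial_volume (bigD1 j)//= ltnn mxE eqxx mulrC; congr (_ * _).
by apply: eq_bigr => i ij; rewrite mxE (negbTE ij).
Qed.

Lemma integral_partial_volume (j : 'I_n.+1) ab x :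
  (\int[lebesgue_measure]_t (partial_volume j ab (update_coord x j t))%:E =
   (partial_volume j.+1 ab x)%:E)%E.
Proof.
under eq_integral => t _ do rewrite partial_volume_update EFinM.
rewrite ge0_integralZl//.
- rewrite integral_indic// setIT [X in (_ * X)%E]lebesgue_measure_segment -EFinM; congr EFin.
  rewrite /partial_volume [in RHS](bigD1 j)//= ltnSn mulrC; congr (_ * _).
  apply: eq_bigr => i ij; rewrite ltnS [in RHS]leq_eqVlt.
  by rewrite (_ : (i == j :> nat) = false)//; apply/negbTE.
- by apply/measurable_EFinP; exact: measurable_indic.
- rewrite lee_fin; apply: prodr_ge0 => i _; case: ifP => _.
    by rewrite le_max lexx.
  by rewrite indicE.
Qed.

(** Induction on the number [j] of coordinates integrated out. For [j = 0] the inequality between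
    indicators is the covering hypothesis; integrating it in the variable [j], with series and
    integral exchanged, gives the case [j + 1]; for [j = n + 1] only volumes remain. *)
Lemma le_box_volume_cover ab (B : nat -> V * V) :
  box ab `<=` \bigcup_k box (B k) ->
  ((box_volume ab)%:E <= \sum_(k <oo) (box_volume (B k))%:E)%E.
Proof.
move=> cov.
have pv0 j' ab' x : (0 <= (partial_volume j' ab' x)%:E)%E.
  by rewrite lee_fin partial_volume_ge0.
suff main j : (j <= n.+1)%N -> forall x, ((partial_volume j ab x)%:E <=
    \sum_(k <oo) (partial_volume j (B k) x)%:E)%E.
  (* Once all coordinates are integrated out, the value does not depend on the point, so [0] is an
     arbitrary choice. *)
  have volE ab' : box_volume ab' = partial_volume n.+1 ab' 0.
    by apply: eq_bigr => i _; rewrite ltn_ord.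
  by rewrite volE; under eq_eseriesr do rewrite volE; exact: main.
elim: j => [_ x|j IH jn x].
  have boxE ab' : box ab' x -> partial_volume 0 ab' x = 1.
    move=> bx; rewrite /partial_volume big1// => i _ /=.
    by rewrite indicE mem_set//=; exact: bx.
  have nboxE : ~ box ab x -> partial_volume 0 ab x = 0.
    move=> /existsNP[i nx]; rewrite /partial_volume (bigD1 i)//= indicE.
    by rewrite memNset ?mul0r.
  have [bx|/nboxE ->] := pselect (box ab x); last exact: nneseries_ge0.
  have [k _ Bk] := cov _ bx.
  rewrite boxE// -(boxE _ Bk).
  apply: (@le_trans _ _ (\sum_(k <= i < k.+1) (partial_volume 0 (B i) x)%:E)%E).
    by rewrite big_nat1.
  apply: (@le_trans _ _ (\sum_(0 <= i < k.+1) (partial_volume 0 (B i) x)%:E)%E).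
    by rewrite big_nat1 big_nat_recr//= leeDr// sume_ge0.
  exact: nneseries_lim_ge.
pose jo := Ordinal jn.
rewrite -(integral_partial_volume jo).
under eq_eseriesr do rewrite -(integral_partial_volume jo).
have mpv ab' : measurable_fun [set: measurableTypeR R]
    (fun t => (partial_volume j ab' (update_coord x jo t))%:E).
  rewrite (_ : (fun t => _) = (fun t => (\prod_(i < n.+1 | i != jo)
     (if (i < j)%N then Num.max 0 (ab'.2 ord0 i - ab'.1 ord0 i)
      else \1_(`[ab'.1 ord0 i, ab'.2 ord0 i]%classic) (x ord0 i)) *
     \1_(`[ab'.1 ord0 jo, ab'.2 ord0 jo]%classic) t)%:E)); last first.
    by apply/funext => t; rewrite (partial_volume_update jo).
  apply/measurable_EFinP; apply: measurable_funM => //.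
rewrite -integral_nneseries//.
apply: ge0_le_integral => //=.
- by apply: ge0_emeasurable_sum.
- by move=> t _; exact/IH/ltnW.
Qed.

Lemma lebesgue_outer_box (ab : V * V) : lebesgue_outer_rV (box ab) = (box_volume ab)%:E.
Proof.
apply/eqP; rewrite eq_le; apply/andP; split; last first.
  by apply: le_ereal_inf_tmp => _ [B cov <-]; exact: le_box_volume_cover.
apply: ereal_inf_lbound.
(* The box alone is a cover; it is padded to a sequence by one-point boxes, which have volume 0. *)
exists (fun k => if k == 0%N then ab else (0, 0)).
  by move=> x abx; exists 0%N.
rewrite (nneseries_split 0 1)/=; last by move=> k _; rewrite lee_fin box_volume_ge0.
rewrite big_nat1 eseries0 ?adde0// => k k1 _.
case: k k1 => // k _; rewrite /box_volume /= (bigD1 ord0)//= !mxE.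
by rewrite subrr maxxx mul0r.
Qed.

(** The hyperplane [x_i = t] cuts the box in two. The [min] and [max] also cover the case where it
    misses the box: one piece then has an empty side, and the truncation in [box_volume] gives it
    volume 0. *)
Lemma box_volume_split (ab : V * V) (i : 'I_n.+1) (t : R) :
  box_volume (ab.1, update_coord ab.2 i (Num.min (ab.2 ord0 i) t)) +
  box_volume (update_coord ab.1 i (Num.max (ab.1 ord0 i) t), ab.2) =
  box_volume ab.
Proof.
rewrite /box_volume (bigD1 i)//= [X in _ + X](bigD1 i)//= [RHS](bigD1 i)//= !mxE eqxx.
set P := (X in _ * X + _); set Q := (X in _ + _ * X); set S := (X in _ = _ * X).
have -> : P = S by apply: eq_bigr => j ji; rewrite mxE (negbTE ji).
have -> : Q = S by apply: eq_bigr => j ji; rewrite mxE (negbTE ji).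
rewrite -mulrDl; congr (_ * _).
set a := ab.1 _ _; set b := ab.2 _ _.
by rewrite /Num.max /Num.min; do ?case: ifPn; rewrite -?leNgt; lra.
Qed.

(** Caratheodory's criterion: cutting each box of a cover of [X] along the hyperplane yields covers
    of the two parts of [X], with the same total volume. *)
Lemma measurable_halfspace (i : 'I_n.+1) (t : R) :
  measurable ([set x : V | x ord0 i <= t] : set (lebRV R n)).
Proof.
apply: le_caratheodory_measurable => X /=.
apply: le_ereal_inf_tmp => _ [B XB <-].
pose L k : V * V := ((B k).1, update_coord (B k).2 i (Num.min ((B k).2 ord0 i) t)).
pose G k : V * V := (update_coord (B k).1 i (Num.max ((B k).1 ord0 i) t), (B k).2).
under eq_eseriesr => k _ do rewrite -(box_volume_split (B k) i t) EFinD.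
rewrite nneseriesD; last 2 first.
- by move=> k _; rewrite lee_fin box_volume_ge0.
- by move=> k _; rewrite lee_fin box_volume_ge0.
apply: leeD; apply: ereal_inf_lbound.
- exists L => // x [Xx /= xt]; have [k _ Bx] := XB _ Xx; exists k => // j.
  have := Bx j; rewrite !in_itv/= mxE => /andP[-> xb]/=.
  case: ifPn => // /eqP ->; rewrite le_min xt andbT.
  by move: (Bx i); rewrite in_itv/= => /andP[].
- exists G => // x [Xx /negP]; rewrite -ltNge => /ltW xt.
  have [k _ Bx] := XB _ Xx; exists k => // j.
  have := Bx j; rewrite !in_itv/= mxE => /andP[xa ->]/=; rewrite andbT.
  case: ifPn => // /eqP ->; rewrite ge_max xt andbT.
  by move: (Bx i); rewrite in_itv/= => /andP[].
Qed.

End box_measure.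

(** * Cubes and outer regularity *)

Section cube_measure.
Context (R : realType) (n : nat).
Local Notation V := 'rV[R]_n.+1.
Local Notation mu := (@lebesgue_measure_rV R n).
Local Notation cube := (@cube R n).

Lemma measurable_open_halfspace (i : 'I_n.+1) (t : R) :
  measurable ([set x : V | x ord0 i < t] : set (lebRV R n)).
Proof.
rewrite (_ : mkset _ = \bigcup_k [set x : V | x ord0 i <= t - k.+1%:R^-1]).
  by apply: bigcup_measurable => k _; exact: measurable_halfspace.
apply/seteqP; split => [x /= xt|x [k _ /= xt]]; last first.
  by rewrite (le_lt_trans xt)// ltrBlDr ltrDl invr_gt0.
have /ltr_add_invr[k] : x ord0 i < t by [].
by move=> xk; exists k => //=; rewrite lerBrDr ltW.
Qed.

Lemma box_bigcap (a b : V) : box (a, b) =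
  \bigcap_(i : 'I_n.+1) (~` [set x : V | x ord0 i < a ord0 i] `&`
                         [set x | x ord0 i <= b ord0 i]).
Proof.
apply/seteqP; split => x.
  move=> bx i _; have := bx i; rewrite in_itv/= => /andP[ax xb]; split => //=.
  by apply/negP; rewrite -leNgt.
by move=> bx i; have [/= /negP] := bx i I; rewrite -leNgt in_itv/= => -> ->.
Qed.

Lemma measurable_box ab : measurable (box ab : set (lebRV R n)).
Proof.
case: ab => a b; rewrite box_bigcap.
apply: fin_bigcap_measurable => // i _; apply: measurableI.
  by apply: measurableC; exact: measurable_open_halfspace.
exact: measurable_halfspace.
Qed.

Lemma lebesgue_measure_box (ab : V * V) : mu (box ab) = (box_volume ab)%:E.
Proof. exact: lebesgue_outer_box. Qed.

(** Half-open cubes are used because those of one dyadic generation partition the space exactly,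
    whereas closed cubes share faces. *)
Definition half_open_cube (Q : cube) : set V :=
  [set x | forall i, corner Q ord0 i <= x ord0 i < corner Q ord0 i + side Q].

Lemma cube_set_box (Q : cube) :
  cube_set Q = box (corner Q, corner Q + const_mx (side Q)).
Proof. by apply/seteqP; split=> x Qx i; have := Qx i; rewrite /= !mxE. Qed.

Lemma measurable_cube_set (Q : cube) :
  measurable (cube_set Q : set (lebRV R n)).
Proof. rewrite cube_set_box; exact: measurable_box. Qed.

Lemma lebesgue_measure_cube_set (Q : cube) :
  mu (cube_set Q) = (side Q ^+ n.+1)%:E.
Proof.
rewrite cube_set_box lebesgue_measure_box; congr EFin.
rewrite /box_volume /= -[in RHS](card_ord n.+1) -prodr_const.
apply: eq_bigr => i _; rewrite !mxE addrAC subrr add0r.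
by apply/max_idPr/ltW/side_gt0.
Qed.

(** Only upper faces: their union is what separates the closed cube from the half-open one. *)
Definition cube_face (Q : cube) (i : 'I_n.+1) : set V :=
  [set x : V | x ord0 i = corner Q ord0 i + side Q /\ cube_set Q x].

Lemma half_open_cubeE (Q : cube) : half_open_cube Q =
  cube_set Q `\` \bigcup_(i : 'I_n.+1) cube_face Q i.
Proof.
apply/seteqP; split => x.
  move=> Qx; split.
    by move=> i; have /andP[ax /ltW xb] := Qx i; rewrite in_itv/= ax xb.
  by move=> [i _ [xi _]]; have := Qx i; rewrite xi ltxx andbF.
move=> [Qx nf] i; have := Qx i; rewrite in_itv/= => /andP[-> xb]/=.
rewrite lt_neqAle xb andbT; apply/eqP => xi; apply: nf.
by exists i.
Qed.

Lemma cube_face_null (Q : cube) i : measurable (cube_face Q i : set (lebRV R n)) /\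
  mu (cube_face Q i) = 0%E.
Proof.
have -> : cube_face Q i =
   box (update_coord (corner Q) i (corner Q ord0 i + side Q),
        corner Q + const_mx (side Q)).
  apply/seteqP; split => x /=.
    move=> [xi Qx] j; have := Qx j; rewrite !in_itv/= !mxE => /andP[ax ->].
    by rewrite andbT; case: eqP => // ->; rewrite xi.
  move=> bx; split; last first.
    move=> j; have := bx j; rewrite !in_itv/= !mxE => /andP[+ ->].
    case: eqP => [->|_ ->]//; rewrite andbT; apply: le_trans.
    by rewrite lerDl ltW// side_gt0.
  have := bx i; rewrite in_itv/= !mxE eqxx => xx.
  by apply/eqP; rewrite eq_le andbC.
split; first exact: measurable_box.
rewrite lebesgue_measure_box /box_volume (bigD1 i)//= !mxE eqxx subrr maxxx.
by rewrite mul0r.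
Qed.

Lemma cube_boundary_null (Q : cube) :
  let N := \bigcup_(i : 'I_n.+1) cube_face Q i in
  measurable (N : set (lebRV R n)) /\ mu N = 0%E.
Proof.
move=> N; have mN : measurable (N : set (lebRV R n)).
  by apply: fin_bigcup_measurable => // i _; exact: (cube_face_null Q i).1.
split => //; apply/eqP; rewrite eq_le measure_ge0 andbT.
apply: le_trans.
  apply: (@content_sub_fsum _ _ _ mu _ [set: 'I_n.+1]
    N (cube_face Q)) => //; first exact: finite_finset.
  by move=> i _; exact: (cube_face_null Q i).1.
by rewrite fsbig1// => i _; exact: (cube_face_null Q i).2.
Qed.

Lemma measurable_half_open_cube (Q : cube) :
  measurable (half_open_cube Q : set (lebRV R n)).
Proof.
rewrite half_open_cubeE; apply: measurableD; first exact: measurable_cube_set.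
exact: (cube_boundary_null Q).1.
Qed.

Lemma half_open_cube_sub (Q : cube) : half_open_cube Q `<=` cube_set Q.
Proof. by rewrite half_open_cubeE; exact: subDsetl. Qed.

Lemma integral_half_open_cube (Q : cube) (f : lebRV R n -> \bar R) :
  measurable_fun (cube_set Q : set (lebRV R n)) f ->
  (forall x, cube_set Q x -> 0 <= f x)%E ->
  (\int[mu]_(x in cube_set Q) f x = \int[mu]_(x in half_open_cube Q) f x)%E.
Proof.
move=> mf f0; have [mN N0] := cube_boundary_null Q.
rewrite half_open_cubeE; apply: ge0_negligible_integral => //.
exact: measurable_cube_set.
Qed.

Lemma lebesgue_measure_half_open_cube (Q : cube) :
  mu (half_open_cube Q) = (side Q ^+ n.+1)%:E.
Proof.
rewrite -lebesgue_measure_cube_set -[LHS]mul1e -[RHS]mul1e.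
rewrite -!integral_cst//; [|exact: measurable_cube_set|exact: measurable_half_open_cube].
by rewrite integral_half_open_cube.
Qed.

Lemma prod_add_cvg0 (c : 'I_n.+1 -> R) :
  \prod_i (c i + d) @[d --> (0 : R)] --> \prod_i c i.
Proof.
rewrite [X in _ --> X](_ : _ = \prod_i (c i + 0)); last first.
  by apply: eq_bigr => i _; rewrite addr0.
apply: (@cvg_big R^o _ *%R) => [|i _]; last first.
  by apply: cvgD; [exact: cvg_cst|exact: cvg_id].
exact: mul_continuous.
Qed.

Lemma box_volume_enlarge (a b : V) (e : R) : 0 < e -> exists2 d : R, 0 < d &
  box_volume (a - const_mx d, b + const_mx d) <= box_volume (a, b) + e.
Proof.
move=> e0.
pose c i : R := Num.max 0 (b ord0 i - a ord0 i).
have /cvgrPdist_le/(_ _ e0)[/= r r0 rP] := @prod_add_cvg0 c.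
(* Moving both ends by [r / 4] lengthens a side by [r / 2], which is within the radius [r] given by
   continuity of the product. *)
exists (r / 4); first by rewrite divr_gt0.
have r2 : `|0 - r / 2| < r.
  by rewrite sub0r normrN ger0_norm ?divr_ge0// ?ltW//; lra.
have /ler_normlP[+ _] := rP _ r2; rewrite opprB lerBlDl => /(le_trans _); apply.
apply: ler_prod => i _; rewrite le_max lexx/= !mxE /c ge_max.
have m0 : 0 <= Num.max 0 (b ord0 i - a ord0 i) by rewrite le_max lexx.
have m1 : b ord0 i - a ord0 i <= Num.max 0 (b ord0 i - a ord0 i).
  by rewrite le_max lexx orbT.
by apply/andP; split; lra.
Qed.

(** A nearly optimal cover costs [e / 2], and enlarging its [k]-th box costs [e / 2^(k+2)]. The last
    clause is the form of openness used later: around each point of [F] the set [U] contains a ball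
    of the maximum norm. *)
Lemma outer_regular (F : set V) (e : R) : 0 < e -> (mu F < +oo)%E ->
  exists U : set V, [/\ measurable (U : set (lebRV R n)), F `<=` U,
   (mu U <= mu F + e%:E)%E &
   forall x, F x -> exists2 r : R, 0 < r &
     forall y : V, (forall i, `|y ord0 i - x ord0 i| <= r) -> U y].
Proof.
move=> e0 Foo.
have Ffin : mu F \is a fin_num by rewrite ge0_fin_numE.
have e20 : 0 < e / 2 by rewrite divr_gt0.
have [_ [B FB <-] /ltW Be] := lb_ereal_inf_adherent e20 Ffin.
have /choice[d dP] : forall k, exists d : R, 0 < d /\
    box_volume ((B k).1 - const_mx d, (B k).2 + const_mx d) <=
    box_volume (B k) + (e / 2) / (2 ^ k.+1)%:R.
  move=> k; have ek : 0 < (e / 2) / (2 ^ k.+1)%:R by rewrite divr_gt0.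
  have [d d0 dB] := box_volume_enlarge (B k).1 (B k).2 ek.
  by exists d; split => //; rewrite -surjective_pairing in dB.
pose B' k := ((B k).1 - const_mx (d k), (B k).2 + const_mx (d k)).
exists (\bigcup_k box (B' k)); split.
- by apply: bigcup_measurable => k _; exact: measurable_box.
- move=> x /FB[k _ Bx]; exists k => // i; have := Bx i.
  rewrite !in_itv/= !mxE => /andP[ax xb]; have [d0 _] := dP k.
  by apply/andP; split; lra.
- apply: (@le_trans _ _ (\sum_(k <oo) (box_volume (B' k))%:E)%E).
    by apply: ereal_inf_lbound; exists B'.
  apply: (@le_trans _ _ (\sum_(k <oo) ((box_volume (B k))%:E +
     ((e / 2) / (2 ^ k.+1)%:R)%:E))%E).
    apply: lee_nneseries => [k _ _|k _]; first by rewrite lee_fin box_volume_ge0.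
    by rewrite -EFinD lee_fin; exact: (dP k).2.
  apply: le_trans (epsilon_trick _ _ _) _; last first.
  + have -> : e%:E = ((e / 2)%:E + (e / 2)%:E)%E by rewrite -EFinD -splitr.
    by rewrite addeA; exact: leeD2r.
  + exact: ltW.
  + by move=> k; rewrite lee_fin box_volume_ge0.
- move=> x /FB[k _ Bx]; exists (d k); first exact: (dP k).1.
  move=> y xy; exists k => // i; have := Bx i.
  rewrite !in_itv/= !mxE => /andP[ax xb]; have := xy i.
  by rewrite ler_norml => /andP[? ?]; apply/andP; split; lra.
Qed.

End cube_measure.

(** * Countable families of measurable sets *)

Section countable_families.
Local Open Scope ereal_scope.
Context d (T : measurableType d) (R : realType).
Variable mu : {measure set T -> \bar R}.
Context (I : countType).

(** Transfers sums over a set of indices, such as dyadic cubes, to series over naturals. An element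
    of [J] serves as value at the naturals that code no index. *)
Lemma countable_enum (J : set I) : J !=set0 ->
  exists (P : set nat) (e : nat -> I), set_inj P e /\ [set e i | i in P] = J.
Proof.
move=> [j0 Jj0]; exists (pickle @` J), (fun i => odflt j0 (pickle_inv i)); split.
  by move=> _ _ /[!inE] -[i Ji <-] [j Jj <-]; rewrite !pickleK_inv/= => ->.
apply/seteqP; split => [_ [_ [i Ji <-] <-]|i Ji]; first by rewrite pickleK_inv.
by exists (pickle i); [exists i|rewrite pickleK_inv].
Qed.

Lemma ge0_integral_bigcup_esum (J : set I) (B : I -> set T) (f : T -> \bar R) :
  (forall i, J i -> measurable (B i)) ->
  measurable_fun (\bigcup_(i in J) B i) f ->
  (forall x, (\bigcup_(i in J) B i) x -> 0 <= f x) ->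
  trivIset J B ->
  \int[mu]_(x in \bigcup_(i in J) B i) f x =
  \esum_(i in J) \int[mu]_(x in B i) f x.
Proof.
have [->|/set0P J0] := eqVneq J set0.
  by rewrite bigcup_set0 integral_set0 esum_set0.
have [P [e [inj_e <-{J J0}]]] := countable_enum J0 => mB mf f0 tB.
rewrite bigcup_image bigcup_mkcond in mf f0 *.
rewrite ge0_integral_bigcup//; last 2 first.
- by move=> k; case: ifPn => // /set_mem Pk; apply: mB; exists k.
- move=> i j _ _ [x []]; case: ifPn => // /set_mem Pi Bi.
  case: ifPn => // /set_mem Pj Bj; apply: inj_e; rewrite ?inE//.
  by apply: tB; [exists i|exists j|exists x].
rewrite esum_set_image//; last first.
  move=> k Pk; apply: integral_ge0 => x Bx; apply: f0; exists k => //.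
  by rewrite mem_set.
rewrite [RHS]eseries_mkcond; apply: eq_eseriesr => i _.
by case: ifPn => //; rewrite integral_set0.
Qed.

Lemma measure_bigcup_esum (J : set I) (B : I -> set T) :
  (forall i, J i -> measurable (B i)) -> trivIset J B ->
  mu (\bigcup_(i in J) B i) = \esum_(i in J) mu (B i).
Proof.
move=> mB tB.
have [J0|/set0P J0] := eqVneq J set0.
  by rewrite J0 bigcup_set0 measure0 esum_set0.
have [P [e [inj_e eJ]]] := countable_enum J0.
have mU : measurable (\bigcup_(i in J) B i).
  rewrite -eJ bigcup_image; apply: bigcup_measurable => k Pk.
  by apply: mB; rewrite -eJ; exists k.
rewrite -[LHS]mul1e -integral_cst// ge0_integral_bigcup_esum//.
by apply: eq_esum => i Ji; rewrite integral_cst ?mul1e//; exact: mB.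
Qed.

Lemma bigcup_countable_measurable (J : set I) (B : I -> set T) :
  (forall i, J i -> measurable (B i)) -> measurable (\bigcup_(i in J) B i).
Proof.
have [->|/set0P J0] := eqVneq J set0; first by rewrite bigcup_set0.
have [P [e [inj_e <-{J J0}]]] := countable_enum J0 => mB.
rewrite bigcup_image; apply: bigcup_measurable => k Pk.
by apply: mB; exists k.
Qed.

Lemma measure_bigcup_le_esum (J : set I) (B : I -> set T) :
  (forall i, J i -> measurable (B i)) ->
  mu (\bigcup_(i in J) B i) <= \esum_(i in J) mu (B i).
Proof.
have [->|/set0P J0] := eqVneq J set0.
  by rewrite bigcup_set0 measure0 esum_set0.
have [P [e [inj_e <-{J J0}]]] := countable_enum J0 => mB.
rewrite bigcup_image bigcup_mkcond.
rewrite esum_set_image// [leRHS]eseries_mkcond.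
rewrite (eq_eseriesr (g := fun i => mu (if i \in P then B (e i) else set0))); last first.
  by move=> i _; case: ifPn.
apply: measure_sigma_subadditive => //.
  by move=> k; case: ifPn => // /set_mem Pk; apply: mB; exists k.
apply: bigcup_measurable => k _.
by case: ifPn => // /set_mem Pk; apply: mB; exists k.
Qed.

Lemma esumZl (J : set I) (a : I -> \bar R) (x : R) : (0 <= x)%R ->
  (forall i, J i -> 0 <= a i) ->
  \esum_(i in J) (x%:E * a i) = x%:E * \esum_(i in J) a i.
Proof.
have [->|/set0P J0] := eqVneq J set0; first by rewrite !esum_set0 mule0.
have [P [e [inj_e <-{J J0}]]] := countable_enum J0 => x0 a0.
have ae0 k : P k -> 0 <= a (e k) by move=> Pk; apply: a0; exists k.
rewrite !esum_set_image//; last first.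
  by move=> k Pk; rewrite mule_ge0// ae0.
by rewrite nneseriesZl// => i /set_mem; exact: ae0.
Qed.

End countable_families.

(** * Dyadic cubes *)

Section dyadic_cubes.
Context (R : realType) (n : nat) (Q0 : cube R n).
Local Notation V := 'rV[R]_n.+1.
Local Notation mu := (@lebesgue_measure_rV R n).

(* [(k, m)] stands for the translate by [m] of the [k]-th dyadic subdivision of [Q0]. *)
Definition dyadic_index := (nat * {ffun 'I_n.+1 -> int})%type.
Implicit Types q r : dyadic_index.

Lemma dyadic_side_gt0 k : 0 < side Q0 / 2 ^+ k.
Proof. by rewrite divr_gt0 ?side_gt0 ?exprn_gt0. Qed.

(** All integer translates are allowed, not only the subcubes of [Q0], since forward translates
    leave [Q0]. *)
Definition dyadic q : cube R n :=
  Cube (corner Q0 + (side Q0 / 2 ^+ q.1) *: \row_i (q.2 i)%:~R)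
       (dyadic_side_gt0 q.1).

Definition dyadic_set q : set V := half_open_cube (dyadic q).

(** Position measured in sides of generation [k], so that its floor is the index of the cube
    containing [x]. *)
Definition dyadic_coord k (x : V) (i : 'I_n.+1) : R :=
  (x ord0 i - corner Q0 ord0 i) / (side Q0 / 2 ^+ k).

Definition index_at k (x : V) : {ffun 'I_n.+1 -> int} :=
  [ffun i => Num.floor (dyadic_coord k x i)].

Definition fwd q : dyadic_index :=
  (q.1, [ffun i => q.2 i + (i == ord_max)%:Z]).

(** The cubes of a generation are the fibres of the floor map; disjointness and nesting thereby
    become facts about floors. *)
Lemma dyadic_setP q x : dyadic_set q x <-> index_at q.1 x = q.2.
Proof.
have s0 := dyadic_side_gt0 q.1.
have E i : corner (dyadic q) ord0 i <= x ord0 i <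
    corner (dyadic q) ord0 i + side (dyadic q) =
    (Num.floor (dyadic_coord q.1 x i) == q.2 i).
  rewrite floor_eq /dyadic_coord ler_pdivlMr// ltr_pdivrMr//= !mxE.
  rewrite intrD mulrDl mul1r lerBrDl ltrBlDl addrA.
  by rewrite [_ * (q.2 i)%:~R]mulrC.
split=> [qx|/ffunP qx i].
  by apply/ffunP => i; rewrite ffunE; apply/eqP; rewrite -E; exact: qx.
by rewrite E -qx ffunE.
Qed.

Lemma dyadic_set_index k x : dyadic_set (k, index_at k x) x.
Proof. exact/dyadic_setP. Qed.

Lemma dyadic_set_same k m r x : dyadic_set (k, m) x -> r.1 = k ->
  dyadic_set r x -> r = (k, m).
Proof.
by case: r => l s /dyadic_setP/= <- /= -> /dyadic_setP/= <-.
Qed.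

(** An integer [m] is at most [u / N] exactly when [m N] is at most [floor u], so [floor u]
    determines [floor (u / N)]. *)
Lemma floor_div_eq (u v : R) (N : nat) : (0 < N)%N ->
  Num.floor u = Num.floor v -> Num.floor (u / N%:R) = Num.floor (v / N%:R).
Proof.
move=> N0 uv; have E (m : int) (w : R) : (m <= Num.floor (w / N%:R)) = (m * N%:Z <= Num.floor w).
  by rewrite !floor_ge_int ler_pdivlMr ?ltr0n// intrM.
have H m : (m <= Num.floor (u / N%:R)) = (m <= Num.floor (v / N%:R)) by rewrite !E uv.
by apply/eqP; rewrite eq_le H lexx -H lexx.
Qed.

(** The coordinate of generation [j] is that of generation [k] divided by the integer [2^(k-j)]. *)
Lemma index_at_coarser j k x y : (j <= k)%N ->
  index_at k x = index_at k y -> index_at j x = index_at j y.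
Proof.
move=> jk /ffunP xy; apply/ffunP => i; have := xy i; rewrite !ffunE.
have E z : dyadic_coord j z i = dyadic_coord k z i / (2 ^ (k - j))%:R.
  have e2 : (2 : R) ^+ k = 2 ^+ j * 2 ^+ (k - j) by rewrite -exprD subnKC.
  rewrite /dyadic_coord natrX e2.
  have := lt0r_neq0 (side_gt0 Q0).
  have : (2 : R) ^+ j != 0 by rewrite expf_neq0.
  have : (2 : R) ^+ (k - j) != 0 by rewrite expf_neq0.
  by move=> *; field; do ?[apply/andP; split].
by rewrite !E; apply: floor_div_eq; rewrite expn_gt0.
Qed.

Lemma dyadic_nested q r x : (r.1 <= q.1)%N ->
  dyadic_set q x -> dyadic_set r x -> dyadic_set q `<=` dyadic_set r.
Proof.
move=> rq /dyadic_setP qx /dyadic_setP rx y /dyadic_setP qy.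
apply/dyadic_setP; rewrite -rx.
by apply: (index_at_coarser rq); rewrite qx qy.
Qed.

Lemma dyadic_set_nonempty q : dyadic_set q (corner (dyadic q)).
Proof. by move=> i; rewrite lexx ltrDl side_gt0. Qed.

Lemma cube_eq (Q Q' : cube R n) : corner Q = corner Q' -> side Q = side Q' -> Q = Q'.
Proof.
case: Q Q' => [a h h0] [b l l0]/= ab hl; move: h0 l0; rewrite ab hl => h0 l0.
by rewrite (bool_irrelevance h0 l0).
Qed.

Lemma forward_dyadic q : forward (dyadic q) = dyadic (fwd q).
Proof.
apply: cube_eq => //=; apply/rowP => i; rewrite !mxE ffunE eqxx/= intrD mulrDr addrA.
by case: (i == ord_max).
Qed.

Definition dyadic_root : dyadic_index := (0%N, [ffun=> 0]).

Lemma dyadic_rootE : dyadic dyadic_root = Q0.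
Proof.
apply: cube_eq => /=; last by rewrite expr0 divr1.
by apply/rowP => i; rewrite !mxE ffunE mulr0 addr0.
Qed.

Lemma dyadic_set_root : dyadic_set dyadic_root = half_open_cube Q0.
Proof. by rewrite /dyadic_set dyadic_rootE. Qed.

Lemma measurable_dyadic_set q : measurable (dyadic_set q : set (lebRV R n)).
Proof. exact: measurable_half_open_cube. Qed.

Lemma lebesgue_measure_dyadic_set q :
  mu (dyadic_set q) = ((side Q0 / 2 ^+ q.1) ^+ n.+1)%:E.
Proof. exact: lebesgue_measure_half_open_cube. Qed.

(** Maximality for inclusion, phrased by generations: a dyadic cube containing [r] has generation at
    most [r.1], so the condition forces it to be [r]. *)
Definition maximal_in (S : set dyadic_index) : set dyadic_index :=
  [set r | S r /\ forall q, S q -> dyadic_set r `<=` dyadic_set q -> (r.1 <= q.1)%N].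

Lemma maximal_in_disjoint S : trivIset (maximal_in S) dyadic_set.
Proof.
move=> r q [Sr mr] [Sq mq] [x [rx qx]].
wlog rq : r q Sr mr Sq mq rx qx / (r.1 <= q.1)%N.
  by move=> H; have /orP[?|?] := leq_total r.1 q.1; [|apply/esym]; exact: H.
have qr : (q.1 <= r.1)%N by apply: mq => //; exact: dyadic_nested qx rx.
case: q Sq mq rq qr qx => k m Sq mq rq qr qx.
by apply: (dyadic_set_same qx) => //; apply/eqP; rewrite eqn_leq rq.
Qed.

(** Among the members of [S] containing [q], one of least generation is maximal; it exists because
    generations are natural numbers, even when [S] is infinite. *)
Lemma maximal_in_cover S q : S q ->
  exists r, [/\ maximal_in S r, (r.1 <= q.1)%N & dyadic_set q `<=` dyadic_set r].
Proof.
move=> Sq.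
pose A k := `[< exists r, [/\ S r, dyadic_set q `<=` dyadic_set r & r.1 = k] >].
have exA : exists k, A k by exists q.1; apply/asboolP; exists q; split.
case: (ex_minnP exA) => k /asboolP[r [Sr qr rk]] kmin.
exists r; split => //.
  split=> // q' Sq' rq'; rewrite rk; apply: kmin; apply/asboolP.
  by exists q'; split => //; exact: subset_trans rq'.
by rewrite rk; apply: kmin; apply/asboolP; exists q; split.
Qed.

Lemma dyadic_set_shift q x :
  dyadic_set q x <-> dyadic_set (fwd q) (x + (side Q0 / 2 ^+ q.1) *: delta_mx ord0 ord_max).
Proof.
have s0 := dyadic_side_gt0 q.1.
split=> qx i; have := qx i; rewrite /= !mxE ffunE eqxx/= intrD mulrDr;
  case: (i == ord_max) => /=; rewrite ?mulr1 ?mulr0; lra.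
Qed.

(* [q] is behind [fwd (fwd q)] by [2 side q <= 2 side r] in the time direction. *)
Lemma dyadic_set_back q r : (r.1 <= q.1)%N ->
  dyadic_set (fwd (fwd q)) `<=` dyadic_set (fwd (fwd r)) ->
  dyadic_set q `<=` dyadic_set r `|` dyadic_set (fwd r) `|` dyadic_set (fwd (fwd r)).
Proof.
move=> rq qr x qx.
have {qr} := qr _ ((dyadic_set_shift _ _).1 ((dyadic_set_shift _ _).1 qx)).
rewrite -addrA -scalerDl.
set sq := side Q0 / _ + _.
have sr : 0 < sq <= 2 * (side Q0 / 2 ^+ r.1).
  have sq0 := dyadic_side_gt0 q.1.
  rewrite /sq/=; apply/andP; split; first by lra.
  suff : side Q0 / 2 ^+ q.1 <= side Q0 / 2 ^+ r.1 by lra.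
  rewrite ler_pM2l ?side_gt0// lef_pV2 ?posrE ?exprn_gt0//.
  by apply: ler_weXn2l => //; rewrite ler1n.
move: sr => /andP[sq0 sr] {rq qx}.
have := dyadic_side_gt0 r.1; move: sr; rewrite /dyadic_set /half_open_cube/=.
set s := side Q0 / _ => sr s0 H.
have Hi i : i != ord_max -> corner Q0 ord0 i + s * (r.2 i)%:~R <= x ord0 i <
    corner Q0 ord0 i + s * (r.2 i)%:~R + s.
  by move=> im; have := H i; rewrite !mxE !ffunE eqxx (negbTE im)/= !addr0 mulr0 addr0.
have := H ord_max; rewrite !mxE !ffunE !eqxx/= !intrD !mulrDr mulr1 => HM.
have [x0|x0] := ltP (x ord0 ord_max) (corner Q0 ord0 ord_max + s * (r.2 ord_max)%:~R + s).
  left; left => i; rewrite !mxE; have [->|/Hi//] := eqVneq i ord_max.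
  by lra.
have [x1|x1] := ltP (x ord0 ord_max) (corner Q0 ord0 ord_max + s * (r.2 ord_max)%:~R + s + s).
  left; right => i; rewrite !mxE ffunE; have [->|/Hi] := eqVneq i ord_max.
    by rewrite /= intrD mulrDr mulr1; lra.
  by rewrite /= addr0.
right => i; rewrite !mxE !ffunE; have [->|/Hi] := eqVneq i ord_max.
  by rewrite /= !intrD !mulrDr !mulr1; lra.
by rewrite /= !addr0.
Qed.

End dyadic_cubes.

(** * Averages and coverings by shifted cubes *)

Section averages.
Context (R : realType) (n : nat).
Local Notation V := 'rV[R]_n.+1.
Local Notation mu := (@lebesgue_measure_rV R n).
Local Notation LV := (lebRV R n).

Lemma integrable_cst_fin (A : set LV) (c : R) : measurable A -> (mu A < +oo)%E ->
  mu.-integrable A (fun=> c%:E).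
Proof.
move=> mA Aoo; apply/integrableP; split; first exact: measurable_cst.
by rewrite integral_cst// lte_mul_pinfty.
Qed.

Lemma integrable_positive_part (A : set LV) (f : V -> R) (c : R) :
  measurable A -> (mu A < +oo)%E -> mu.-integrable A (EFin \o f) ->
  mu.-integrable A (fun x => (Num.max (f x - c) 0)%:E).
Proof.
move=> mA Aoo intf.
have intfc : mu.-integrable A (EFin \o (fun x => f x - c)).
  exact: (integrableB mA intf (integrable_cst_fin c mA Aoo)).
have mfc : measurable_fun A (fun x : LV => f x - c).
  by apply/measurable_EFinP; exact: (measurable_int mu intfc).
apply: le_integrable intfc => //.
  by apply/measurable_EFinP; exact: measurable_maxr.
move=> x _; rewrite lee_fin [leLHS]ger0_norm ?le_max ?lexx ?orbT//.
by rewrite ge_max ler_norm normr_ge0.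
Qed.

Lemma measurable_positive_part (f : V -> R) (c : R) :
  measurable_fun [set: LV] (f : LV -> R) ->
  measurable_fun [set: LV] (fun x : LV => (Num.max (f x - c) 0)%:E).
Proof.
move=> mf; apply/measurable_EFinP; apply: measurable_maxr => //.
exact: measurable_funB.
Qed.

(** Integrate [f <= c + (f - c)^+] over [Q]; the upper faces are null, so the right side may be
    taken over the half-open cube. *)
Lemma le_average_positive_part (Q : cube R n) (f : V -> R) (c : R) :
  mu.-integrable (cube_set Q : set LV) (EFin \o f) ->
  (((average (cube_set Q) f - c) * side Q ^+ n.+1)%:E <=
   \int[mu]_(x in half_open_cube Q) (Num.max (f x - c) 0)%:E)%E.
Proof.
move=> intf; have mQ := measurable_cube_set Q.
have muQ := lebesgue_measure_cube_set Q.
have Qoo : (mu (cube_set Q) < +oo)%E by rewrite muQ ltry.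
have intp := integrable_positive_part c mQ Qoo intf.
have intc := integrable_cst_fin c mQ Qoo.
rewrite -integral_half_open_cube//; last 2 first.
- exact: measurable_int intp.
- by move=> x _; rewrite lee_fin le_max lexx orbT.
have s0 : 0 < side Q ^+ n.+1 by rewrite exprn_gt0// side_gt0.
rewrite mulrBl EFinB leeBlDr// /average [mu (cube_set Q)]muQ/=.
rewrite mulrAC mulVf ?gt_eqF// mul1r /Rintegral fineK; last exact: integrable_fin_num.
have -> : (c * side Q ^+ n.+1)%:E = (\int[mu]_(x in cube_set Q) c%:E)%E.
  by rewrite integral_cst// [X in (_ * X)%E]muQ.
rewrite -integralD//; apply: le_integral => //; first exact: integrableD.
by move=> x _; rewrite -EFinD lee_fin -lerBlDr le_max lexx.
Qed.

Lemma compact_cube_set (Q : cube R n) : compact (cube_set Q).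
Proof.
apply: (rV_compact (A := fun i =>
  `[corner Q ord0 i, corner Q ord0 i + side Q]%classic)) => i.
exact: segment_compact.
Qed.

Lemma locally_integrable_compact (f : V -> R) (K : set V) :
  locally_integrable_rV f -> compact K -> mu.-integrable (K : set LV) (EFin \o f).
Proof.
move=> [mf lf] cK; apply/integrableP; split; last exact: lf.
by apply/measurable_EFinP; exact: measurable_funTS.
Qed.

Lemma locally_integrable_cube (f : V -> R) (Q : cube R n) :
  locally_integrable_rV f -> mu.-integrable (cube_set Q : set LV) (EFin \o f).
Proof. by move=> lf; apply: locally_integrable_compact => //; exact: compact_cube_set. Qed.

End averages.

Section covering.
Context (R : realType) (n : nat) (Q0 : cube R n).
Local Notation V := 'rV[R]_n.+1.
Local Notation mu := (@lebesgue_measure_rV R n).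
Local Notation LV := (lebRV R n).
Local Notation dyadic_set := (dyadic_set Q0).

Lemma fwd_inj : injective (@fwd n).
Proof.
move=> [k m] [l m'] [<- /ffunP mm']; congr (_, _); apply/ffunP => i.
by have := mm' i; rewrite !ffunE => /addIr.
Qed.

(** A one-sided Vitali covering argument. The maximal cubes among the shifted ones are disjoint, so
    their integrals of [h] add up to at most that over [A]; by [dyadic_set_back] the unshifted cubes
    are covered by the sets [B r], of measure at most three times that of [r]. It serves both the
    good-lambda inequality and the differentiation theorem. *)
Lemma shifted_covering (h : LV -> \bar R) (I : set (dyadic_index n)) (A : set V) (t : R) :
  measurable_fun [set: LV] h -> (forall x, 0 <= h x)%E -> measurable (A : set LV) ->
  0 <= t ->
  (forall q, I q -> dyadic_set (fwd (fwd q)) `<=` A) ->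
  (forall q, I q -> (t%:E * mu (dyadic_set q) <=
     \int[mu]_(x in dyadic_set (fwd (fwd q))) h x)%E) ->
  (t%:E * mu (\bigcup_(q in I) dyadic_set q) <= 3%:E * \int[mu]_(x in A) h x)%E.
Proof.
move=> mh h0 mA t0 IA It.
pose S := [set fwd (fwd q) | q in I].
pose J := [set r | I r /\ maximal_in Q0 S (fwd (fwd r))].
pose B r := dyadic_set r `|` dyadic_set (fwd r) `|` dyadic_set (fwd (fwd r)).
have mD r := measurable_dyadic_set Q0 r.
have mB r : measurable (B r : set LV) by do 2 apply: measurableU => //.
have tJ : trivIset J (fun r => dyadic_set (fwd (fwd r))).
  by move=> r s [_ Jr] [_ Js] /(maximal_in_disjoint Jr Js)/fwd_inj/fwd_inj.
have IJ : \bigcup_(q in I) dyadic_set q `<=` \bigcup_(r in J) B r.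
  move=> x [q Iq qx].
  have [_ [[[r Ir <-] rmax] rq qr]] : exists r, [/\ maximal_in Q0 S r,
      (r.1 <= (fwd (fwd q)).1)%N & dyadic_set (fwd (fwd q)) `<=` dyadic_set r].
    by apply: maximal_in_cover; exists q.
  have Bx : B r x by exact: (@dyadic_set_back _ _ Q0 q r rq qr).
  by exists r => //; split => //; split => //; exists r.
have muB r : (mu (B r) <= 3%:E * mu (dyadic_set r))%E.
  have -> : (3%:E * mu (dyadic_set r) = mu (dyadic_set r) +
      mu (dyadic_set (fwd r)) + mu (dyadic_set (fwd (fwd r))))%E.
    by rewrite !lebesgue_measure_dyadic_set -!EFinD -EFinM; congr EFin => /=; ring.
  apply: (le_trans (measureU2 _ _ _)) => //; first exact: measurableU.
  by apply: leeD2r; exact: measureU2.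
have muJ : (mu (\bigcup_(q in I) dyadic_set q) <=
    3%:E * \esum_(r in J) mu (dyadic_set r))%E.
  rewrite -esumZl//.
  apply: (@le_trans _ _ (mu (\bigcup_(r in J) B r))).
    apply: le_measure => //; rewrite inE; exact: bigcup_countable_measurable.
  apply: (le_trans (measure_bigcup_le_esum _ _)) => //.
  by apply: le_esum => r _; exact: muB.
apply: (le_trans (lee_wpmul2l _ muJ)); first by rewrite lee_fin.
rewrite muleCA lee_wpmul2l// -esumZl//.
apply: (@le_trans _ _ (\esum_(r in J) \int[mu]_(x in dyadic_set (fwd (fwd r))) h x)%E).
  by apply: le_esum => r [Ir _]; exact: It.
rewrite -ge0_integral_bigcup_esum//; last exact: measurable_funTS.
apply: ge0_subset_integral => //; first exact: bigcup_countable_measurable.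
  exact: measurable_funTS.
by move=> x [r [Ir _] rx]; exact: (IA _ Ir).
Qed.

(* [2 side q <= side r], because [q] is strictly smaller than [r]. *)
Lemma shifted_subcube q r : (r.1 < q.1)%N -> dyadic_set q `<=` dyadic_set r ->
  dyadic_set (fwd (fwd q)) `<=`
    cube_set (dyadic Q0 r) `|` cube_set (forward (dyadic Q0 r)).
Proof.
move=> rq qr y qy.
have s2 : 2 * (side Q0 / 2 ^+ q.1) <= side Q0 / 2 ^+ r.1.
  rewrite mulrCA ler_pM2l ?side_gt0// -[leRHS]mul1r ler_pdivlMr ?exprn_gt0// mulrAC.
  rewrite ler_pdivrMr ?exprn_gt0// mul1r -exprS.
  by apply: ler_weXn2l => //; rewrite ler1n.
have sq0 := dyadic_side_gt0 Q0 q.1.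
pose e : V := delta_mx ord0 ord_max.
pose x := y - (2 * (side Q0 / 2 ^+ q.1)) *: e.
have qx : dyadic_set q x.
  apply/dyadic_set_shift/dyadic_set_shift.
  rewrite -addrA -scalerDl /= (_ : side Q0 / 2 ^+ q.1 + side Q0 / 2 ^+ q.1 =
    2 * (side Q0 / 2 ^+ q.1)); first by rewrite subrK.
  by ring.
have {qr qx} rx := qr _ qx.
have xE i : x ord0 i = y ord0 i - (i == ord_max)%:R * (2 * (side Q0 / 2 ^+ q.1)).
  by rewrite !mxE eqxx/= mulrC.
have [yr|yr] := leP (y ord0 ord_max) (corner (dyadic Q0 r) ord0 ord_max + side (dyadic Q0 r)).
  left=> i; have := rx i; rewrite xE in_itv/=.
  have [->|im] := eqVneq i ord_max; rewrite ?mul1r ?mul0r ?subr0.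
    by move: yr => /=; lra.
  by move=> /andP[-> /ltW ->].
right=> i; have := rx i; rewrite xE in_itv/= [X in X + _ * _]lock !mxE -lock eqxx/=.
have [->|im] := eqVneq i ord_max; rewrite ?mul1r ?mul0r ?subr0 ?mulr1 ?mulr0 ?addr0.
  by move: yr; rewrite /= !mxE; lra.
by move=> /andP[-> /ltW ->].
Qed.

End covering.

(** * The good-lambda inequality *)

Section good_lambda.
Context (R : realType) (n : nat) (Q0 : cube R n) (f : 'rV[R]_n.+1 -> R).
Hypothesis locf : locally_integrable_rV f.
Local Notation V := 'rV[R]_n.+1.
Local Notation mu := (@lebesgue_measure_rV R n).
Local Notation LV := (lebRV R n).
Local Notation dyadic_set := (dyadic_set Q0).
Local Notation dyadic := (dyadic Q0).
Local Notation root := (dyadic_root n).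

Lemma osc_plus_ge0 (Q : cube R n) : 0 <= osc_plus f Q.
Proof.
rewrite /osc_plus /average mulr_ge0 ?invr_ge0 ?fine_ge0//.
by apply: integral_ge0 => x _; rewrite lee_fin le_max lexx orbT.
Qed.

(** The factor 2 bounds the measure of the union of [Q] and [Q^+] by that of [Q]. Since [average] is
    defined through [fine], finiteness of the measure and of the integral has to be checked before
    the division can be undone. *)
Lemma integral_positive_part_osc_plus (Q : cube R n) :
  (\int[mu]_(x in cube_set Q `|` cube_set (forward Q))
     (Num.max (f x - average (cube_set (forward (forward Q))) f) 0)%:E
   <= (2 * side Q ^+ n.+1 * osc_plus f Q)%:E)%E.
Proof.
set c := average _ f; set A := _ `|` _.
have mQ := measurable_cube_set Q; have mQ' := measurable_cube_set (forward Q).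
have mA : measurable (A : set LV) by exact: measurableU.
have muQ := lebesgue_measure_cube_set Q.
have muQ' := lebesgue_measure_cube_set (forward Q).
have s0 : 0 < side Q ^+ n.+1 by rewrite exprn_gt0// side_gt0.
have mh : measurable_fun [set: LV] (fun x : LV => (Num.max (f x - c) 0)%:E).
  by apply: measurable_positive_part; exact: locf.1.
have h0 x : (0 <= (Num.max (f x - c) 0)%:E)%E by rewrite lee_fin le_max lexx orbT.
have muA : (mu A <= (2 * side Q ^+ n.+1)%:E)%E.
  apply: (le_trans (measureU2 _ _ _)) => //.
  by rewrite [X in (X + _)%E]muQ [X in (_ + X)%E]muQ' -EFinD lee_fin/=; lra.
have Aint : (\int[mu]_(x in A) (Num.max (f x - c) 0)%:E < +oo)%E.
  apply: integrable_lty => //; apply: integrable_positive_part => //.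
    by rewrite (le_lt_trans muA) ?ltry.
  by apply: locally_integrable_compact => //; apply: compactU; exact: compact_cube_set.
have muA0 : (0 < mu A)%E.
  apply: (@lt_le_trans _ _ (mu (cube_set Q))); first by rewrite [ltRHS]muQ lte_fin.
  by apply: le_measure; rewrite ?inE//; exact: subsetUl.
have Afin : mu A \is a fin_num by rewrite ge0_fin_numE// (le_lt_trans muA) ?ltry.
have Ifin : (\int[mu]_(x in A) (Num.max (f x - c) 0)%:E)%E \is a fin_num.
  by rewrite ge0_fin_numE// integral_ge0.
have fA0 : 0 < fine (mu A) by rewrite fine_gt0// muA0 (le_lt_trans muA) ?ltry.
rewrite -(fineK Ifin) lee_fin.
have -> : fine (\int[mu]_(x in A) (Num.max (f x - c) 0)%:E)%E =
    fine (mu A) * osc_plus f Q.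
  by rewrite /osc_plus /average mulrA mulfV ?gt_eqF// mul1r.
rewrite ler_wpM2r ?osc_plus_ge0//.
by rewrite -lee_fin fineK.
Qed.

Definition shifted_average (q : dyadic_index n) : R :=
  average (cube_set (dyadic (fwd (fwd q)))) f.

Definition stopping (a : R) : set (dyadic_index n) :=
  [set q | dyadic_set q `<=` dyadic_set root /\ a < shifted_average q].

Definition stopping_set (a : R) : set V := \bigcup_(q in stopping a) dyadic_set q.

(** The upper bound on the average of [r] fixes the reference level in its oscillation, while its
    stopping child makes the stopping set fill a fixed proportion of [r]. *)
Definition parents (a : R) : set (dyadic_index n) :=
  [set r | [/\ dyadic_set r `<=` dyadic_set root, shifted_average r <= a &
    exists q, [/\ stopping a q, q.1 = r.1.+1 & dyadic_set q `<=` dyadic_set r]]].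

Definition stopping_parents (a : R) := maximal_in Q0 (parents a).

Lemma measurable_stopping_set a : measurable (stopping_set a : set LV).
Proof.
by apply: bigcup_countable_measurable => q _; exact: measurable_dyadic_set.
Qed.

(** Take the maximal cube [s] of level [a] around [q]. By maximality its dyadic parent does not
    stop, hence belongs to [parents a]; a maximal element of [parents a] above it is strictly larger
    than [s], and so than [q]. *)
Lemma stopping_parents_cover (a b : R) q : shifted_average root <= a -> a <= b ->
  stopping b q -> exists r, [/\ stopping_parents a r, (r.1 < q.1)%N &
    dyadic_set q `<=` dyadic_set r].
Proof.
move=> ca ab [q0 bq].
have aq : stopping a q by split => //; exact: le_lt_trans bq.
have [s [[[s0 sa] smax] sq qs]] := maximal_in_cover Q0 aq.
have xs := dyadic_set_nonempty Q0 s; set x := corner _ in xs.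
(* The root does not stop at level [a], so [s] is a proper subcube and has a parent inside [Q0]. *)
have s1 : (0 < s.1)%N.
  rewrite lt0n; apply/eqP => s10; move: sa.
  by rewrite (dyadic_set_same (s0 _ xs) s10 xs) ltNge ca.
pose r : dyadic_index n := (s.1.-1, index_at Q0 s.1.-1 x).
have rx : dyadic_set r x by exact: dyadic_set_index.
have rs : (r.1 < s.1)%N by rewrite /= prednK.
have sr : dyadic_set s `<=` dyadic_set r by apply: (dyadic_nested _ xs rx); exact: ltnW.
have r0 : dyadic_set r `<=` dyadic_set root by apply: (dyadic_nested _ rx); last exact: s0.
have ra : shifted_average r <= a.
  rewrite leNgt; apply/negP => ra.
  by have := smax r (conj r0 ra) sr; rewrite leqNgt rs.
have Pr : parents a r by split => //; exists s; split => //=; rewrite prednK.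
have [t [tP tr rt]] := maximal_in_cover Q0 Pr.
exists t; split => //; first by rewrite (leq_ltn_trans tr)// (leq_trans rs).
by apply: subset_trans rt; exact: subset_trans sr.
Qed.

(** The reference level of [osc_plus] on [r] is at most [a] and the averages of the cubes [q] exceed
    [b], so [shifted_covering] applies with [t = b - a]. The constant is [6 = 3 * 2]: covering times
    measure of the union. *)
Lemma stopping_parent_bound (a b : R) r : a <= b -> stopping_parents a r ->
  ((b - a)%:E * mu (\bigcup_(q in [set q | [/\ stopping b q, (r.1 < q.1)%N &
      dyadic_set q `<=` dyadic_set r]]) dyadic_set q) <=
   (6 * side (dyadic r) ^+ n.+1 * osc_plus f (dyadic r))%:E)%E.
Proof.
move=> ab [[r0 ra _] _].
pose c := average (cube_set (forward (forward (dyadic r)))) f.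
have cE : c = shifted_average r by rewrite /c !forward_dyadic.
apply: le_trans.
  apply: (@shifted_covering _ _ Q0 (fun x => (Num.max (f x - c) 0)%:E) _
    (cube_set (dyadic r) `|` cube_set (forward (dyadic r))) (b - a)).
  - by apply: measurable_positive_part; exact: locf.1.
  - by move=> x; rewrite lee_fin le_max lexx orbT.
  - by apply: measurableU; exact: measurable_cube_set.
  - by rewrite subr_ge0.
  - by move=> q [_ rq qr]; exact: shifted_subcube.
  - move=> q [[_ bq] rq qr].
    have intf := locally_integrable_cube (dyadic (fwd (fwd q))) locf.
    apply: le_trans (le_average_positive_part c intf).
    rewrite lebesgue_measure_dyadic_set -EFinM lee_fin.
    rewrite cE; apply: ler_wpM2r (lerB (ltW bq) ra).
    exact: exprn_ge0 (ltW (dyadic_side_gt0 Q0 q.1)).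
apply: (@le_trans _ _ (3%:E * (2 * side (dyadic r) ^+ n.+1 * osc_plus f (dyadic r))%:E)%E).
  by apply: lee_wpmul2l (integral_positive_part_osc_plus _); rewrite lee_fin.
by rewrite -EFinM lee_fin !mulrA -natrM.
Qed.

(** Each parent contains a stopping cube of half its side, hence of [2^-(n+1)] times its measure;
    the parents are disjoint, so their intersections with the stopping set add up. *)
Lemma stopping_parents_measure (a : R) :
  (\esum_(r in stopping_parents a) mu (dyadic_set r) <=
   (2 ^+ n.+1)%:E * mu (stopping_set a))%E.
Proof.
have mE := measurable_stopping_set a.
have mD r := measurable_dyadic_set Q0 r.
apply: (@le_trans _ _ (\esum_(r in stopping_parents a)
    ((2 ^+ n.+1)%:E * mu (stopping_set a `&` dyadic_set r)))%E).
  apply: le_esum => r [[r0 ra [q [qa qr rq]]] _].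
  apply: (@le_trans _ _ ((2 ^+ n.+1)%:E * mu (dyadic_set q))%E).
    rewrite !lebesgue_measure_dyadic_set -EFinM lee_fin qr -exprMn.
    rewrite (_ : 2 * (side Q0 / 2 ^+ r.1.+1) = side Q0 / 2 ^+ r.1)// exprS.
    have : (2 : R) ^+ r.1 != 0 by rewrite expf_neq0.
    by move=> ?; field.
  rewrite lee_wpmul2l ?lee_fin ?exprn_ge0//.
  apply: le_measure; rewrite ?inE//; first exact: measurableI.
  by move=> x qx; split; [exists q|exact: rq].
rewrite esumZl ?exprn_ge0//.
rewrite lee_wpmul2l ?lee_fin ?exprn_ge0//.
rewrite -measure_bigcup_esum.
- apply: le_measure; rewrite ?inE//; last by move=> x [r _ []].
  by apply: bigcup_countable_measurable => r _; exact: measurableI.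
- by move=> r _; exact: measurableI.
- move=> r s Pr Ps [x [[_ rx] [_ sx]]].
  by apply: (maximal_in_disjoint Pr Ps); exists x.
Qed.

(** Links the two notions of disjointness: disjoint half-open cubes are non-overlapping. *)
Lemma interior_cube_set (Q : cube R n) : interior (cube_set Q) `<=` half_open_cube Q.
Proof.
move=> x /nbhs_ballP[e /= e0 xe] i.
have := xe _ (ballxx x e0) i; rewrite in_itv/= => /andP[-> _]/=.
(* Raising every coordinate by [e / 2] stays in the cube, so [x] lies strictly below the upper
   faces. *)
have /xe/(_ i) : ball x e (x + const_mx (e / 2)).
  split=> // j k; rewrite /ball/= (ord1 j) !mxE opprD addNKr normrN.
  by rewrite ger0_norm ?divr_ge0 ?ltW//; lra.
by rewrite in_itv/= !mxE => /andP[_]; apply: lt_le_trans; lra.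
Qed.

(** The stopping parents form an admissible family: they are disjoint subcubes of [Q0], so their
    total measure is finite. They are indexed by their codes; the default [root] is taken only
    outside [D]. *)
Lemma stopping_parents_JNp (p a : R) :
  (\esum_(r in stopping_parents a)
     (mu (dyadic_set r) * (osc_plus f (dyadic r) `^ p)%:E) <=
   ereal_sup (JNp_plus_sums p f))%E.
Proof.
pose Q i := dyadic (odflt root (pickle_inv i)).
pose D := [set pickle r | r in stopping_parents a].
have inj : set_inj (stopping_parents a) (@pickle (dyadic_index n)).
  by move=> r s _ _; exact: (pcan_inj pickleK_inv).
have muE r : mu (cube_set (Q (pickle r))) = mu (dyadic_set r).
  rewrite /Q pickleK_inv/= [LHS]lebesgue_measure_cube_set.
  by rewrite [RHS]lebesgue_measure_dyadic_set.
apply: ereal_sup_ubound; exists D, Q; split.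
- move=> _ _ [r Pr <-] [s Ps <-]; rewrite /Q !pickleK_inv/= => -[x [rx sx]].
  congr pickle; apply: (maximal_in_disjoint Pr Ps); exists x.
  by split; exact: interior_cube_set.
- rewrite (esum_image _ _ _ inj); under eq_esum do rewrite muE.
  rewrite -measure_bigcup_esum; last 2 first.
  + by move=> r _; exact: measurable_dyadic_set.
  + exact: maximal_in_disjoint.
  apply: (@le_lt_trans _ _ (mu (dyadic_set root))).
    apply: le_measure; rewrite ?inE.
    + by apply: bigcup_countable_measurable => q _; exact: measurable_dyadic_set.
    + exact: measurable_dyadic_set.
    + by move=> x [r [[r0 _ _] _] rx]; exact: r0.
  by rewrite [ltLHS]lebesgue_measure_dyadic_set ltry.
- rewrite (esum_image _ _ _ inj).
  apply: eq_esum => r _.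
  rewrite [X in (_ = X * _)%E]muE.
  by rewrite /Q pickleK_inv.
Qed.

(* This replaces Hoelder's inequality in the sum over the stopping parents. *)
Lemma le_powR_linear (p s o : R) : 1 < p -> 0 < s -> 0 <= o ->
  o <= s + s `^ (1 - p) * o `^ p.
Proof.
move=> p1 s0 o0; have [os|so] := leP o s.
  by rewrite (le_trans os)// lerDl mulr_ge0// powR_ge0.
have o1 : 0 < o by exact: lt_trans so.
apply: (@le_trans _ _ (s `^ (1 - p) * o `^ p)); last by rewrite lerDr ltW.
have -> : s `^ (1 - p) = (s `^ (p - 1))^-1 by rewrite -powRN opprB.
rewrite mulrC ler_pdivlMr ?powR_gt0//.
have -> : o `^ p = o * o `^ (p - 1).
  by rewrite -{1}(subrK 1 p) (@powRD _ o (p - 1) 1) ?(gt_eqF o1) ?implybT// powRr1// mulrC.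
rewrite ler_pM2l//.
have p0 : 0 <= p - 1 by rewrite subr_ge0 ltW.
by apply: ge0_ler_powR; rewrite // ?nnegrE ltW.
Qed.

(** Sum [stopping_parent_bound] over the stopping parents and split each oscillation by
    [le_powR_linear]. The parameter [s] is free here, and is later taken proportional to [b - a]. *)
Lemma good_lambda (p a b s : R) : 1 < p -> shifted_average root <= a -> a <= b ->
  0 < s ->
  ((b - a)%:E * mu (stopping_set b) <=
   (6 * s * 2 ^+ n.+1)%:E * mu (stopping_set a) +
   (6 * s `^ (1 - p))%:E * ereal_sup (JNp_plus_sums p f))%E.
Proof.
move=> p1 ca ab s0; have ab0 : 0 <= b - a by rewrite subr_ge0.
pose I r := [set q | [/\ stopping b q, (r.1 < q.1)%N & dyadic_set q `<=` dyadic_set r]].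
pose G r : set LV := \bigcup_(q in I r) dyadic_set q.
pose P := stopping_parents a.
have mG r : measurable (G r).
  by apply: bigcup_countable_measurable => q _; exact: measurable_dyadic_set.
have bE : (mu (stopping_set b) <= \esum_(r in P) mu (G r))%E.
  apply: le_trans (measure_bigcup_le_esum mu (fun r _ => mG r)).
  apply: le_measure; rewrite ?inE; [exact: measurable_stopping_set|exact: bigcup_countable_measurable|].
  move=> x [q bq qx]; have [r [Pr rq qr]] := stopping_parents_cover ca ab bq.
  by exists r => //; exists q.
apply: (le_trans (lee_wpmul2l _ bE)); first by rewrite lee_fin.
rewrite -esumZl//.
apply: (@le_trans _ _ (\esum_(r in P) ((6 * s)%:E * mu (dyadic_set r) +
  (6 * s `^ (1 - p))%:E * (mu (dyadic_set r) * (osc_plus f (dyadic r) `^ p)%:E)))%E).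
  apply: le_esum => r Pr; apply: (le_trans (stopping_parent_bound ab Pr)).
  rewrite lebesgue_measure_dyadic_set -!EFinM -EFinD lee_fin.
  have := le_powR_linear p1 s0 (osc_plus_ge0 (dyadic r)).
  set o := osc_plus _ _; set v := _ ^+ _ => ov.
  have v0 : 0 <= 6 * v by apply: mulr_ge0 => //; exact: exprn_ge0 (ltW (dyadic_side_gt0 Q0 r.1)).
  apply: le_trans (ler_wpM2l v0 ov) _.
  by rewrite /v /=; lra.
have c1 : 0 <= 6 * s by rewrite mulr_ge0// ltW.
have c2 : 0 <= 6 * s `^ (1 - p) by rewrite mulr_ge0// powR_ge0.
have F0 r : (0 <= mu (dyadic_set r) * (osc_plus f (dyadic r) `^ p)%:E)%E.
  by rewrite mule_ge0// lee_fin powR_ge0.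
rewrite esumD; last 2 first.
- by move=> r _; rewrite mule_ge0.
- by move=> r _; rewrite mule_ge0.
rewrite (esumZl c1)// (esumZl c2)//.
apply: leeD.
  rewrite [in leRHS]EFinM -muleA; apply: lee_wpmul2l => //.
  exact: stopping_parents_measure.
by apply: lee_wpmul2l => //; exact: stopping_parents_JNp.
Qed.

End good_lambda.

(** * Differentiation *)

Lemma exp2_archimedean (R : realType) (x : R) : 0 <= x -> exists k, x < 2 ^+ k.
Proof.
move=> x0; exists (Num.bound x); apply: lt_le_trans (archi_boundP x0) _.
by rewrite -natrX ler_nat ltnW// ltn_expl.
Qed.

Section differentiation.
Context (R : realType) (n : nat) (Q0 : cube R n) (f : 'rV[R]_n.+1 -> R).
Hypothesis locf : locally_integrable_rV f.
Local Notation V := 'rV[R]_n.+1.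
Local Notation mu := (@lebesgue_measure_rV R n).
Local Notation LV := (lebRV R n).
Local Notation dyadic_set := (dyadic_set Q0).
Local Notation dyadic := (dyadic Q0).
Local Notation root := (dyadic_root n).
Local Notation stopping := (stopping Q0 f).
Local Notation stopping_set := (stopping_set Q0 f).
Local Notation shifted_average := (shifted_average Q0 f).

Lemma le_average_negative_part (Q : cube R n) (c : R) :
  (((c - average (cube_set Q) f) * side Q ^+ n.+1)%:E <=
   \int[mu]_(x in half_open_cube Q) (Num.max (c - f x) 0)%:E)%E.
Proof.
have mQ := measurable_cube_set Q.
have intf := locally_integrable_cube Q locf.
have intNf : mu.-integrable (cube_set Q : set LV) (EFin \o (fun x => - f x)).
  exact: (integrableN intf).
have := le_average_positive_part (- c) intNf.
have -> : average (cube_set Q) (fun x => - f x) = - average (cube_set Q) f.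
  rewrite /average -mulrN; congr (_ * _).
  under eq_Rintegral do rewrite -mulN1r.
  by rewrite RintegralZl// mulN1r.
rewrite opprK addrC => /le_trans; apply.
by under eq_integral do rewrite addrC.
Qed.

(** The factor 3 matches [dyadic_shift_dist]: a cube together with its second translate spans three
    sides. *)
Lemma exists_small_dyadic (r : R) : 0 < r -> exists k, 3 * (side Q0 / 2 ^+ k) <= r.
Proof.
move=> r0; have h0 := side_gt0 Q0.
have x0 : 0 <= 3 * side Q0 / r by rewrite divr_ge0 ?mulr_ge0 ?ltW.
have [k xk] := exp2_archimedean x0.
exists k; rewrite mulrA ler_pdivrMr ?exprn_gt0// ltW//.
by move: xk; rewrite ltr_pdivrMr// [r * _]mulrC.
Qed.

Lemma dyadic_shift_dist q (x y : V) : dyadic_set q x -> dyadic_set (fwd (fwd q)) y ->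
  forall i, `|y ord0 i - x ord0 i| <= 3 * (side Q0 / 2 ^+ q.1).
Proof.
move=> qx qy i; have s0 := dyadic_side_gt0 Q0 q.1.
have := qx i; have := qy i; rewrite /= !mxE !ffunE ler_norml.
case: (i == ord_max) => /=; rewrite ?addr0 ?intrD ?mulrDr ?mulr1;
  by move=> /andP[? ?] /andP[? ?]; apply/andP; split; lra.
Qed.

(** A fixed compact set that contains the shifted cubes of all dyadic subcubes of [Q0]; the third
    cube serves [Q0] itself. *)
Let B : set V := cube_set Q0 `|` cube_set (forward Q0) `|` cube_set (forward (forward Q0)).

Lemma shifted_subcube_root q : dyadic_set q `<=` dyadic_set root ->
  dyadic_set (fwd (fwd q)) `<=` B.
Proof.
have [q0|q0] := posnP q.1 => qr x qx.
  have qE : q = root.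
    have := dyadic_set_nonempty Q0 q => c.
    exact: (dyadic_set_same (qr _ c) q0 c).
  right; rewrite -{1}(dyadic_rootE Q0) !forward_dyadic -qE.
  exact: half_open_cube_sub qx.
have := shifted_subcube (r := root) q0 qr qx.
by rewrite (dyadic_rootE Q0); left.
Qed.

(** Points where [f] exceeds [a] by the margin [e] although every dyadic subcube of [Q0] around them
    has shifted average at most [a]. *)
Definition exceptional_set (a e : R) : set V :=
  [set x | [/\ dyadic_set root x, a + e < f x & ~ stopping_set a x]].

Lemma measurable_superlevel (c : R) : measurable ([set x | c < f x] : set LV).
Proof.
have := locf.1 measurableT _ (measurable_itv `]c, +oo[).
rewrite setTI; congr measurable.
by apply/seteqP; split => x /=; rewrite in_itv/= andbT.
Qed.

Lemma measurable_exceptional_set a e : measurable (exceptional_set a e : set LV).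
Proof.
rewrite (_ : exceptional_set a e = dyadic_set root `&` [set x | a + e < f x] `&`
    ~` stopping_set a).
  apply: measurableI; last by apply: measurableC; exact: measurable_stopping_set.
  apply: measurableI; first exact: measurable_dyadic_set.
  exact: measurable_superlevel.
by apply/seteqP; split => [x [? ? ?]|x [[? ?] ?]].
Qed.

(* Lebesgue's differentiation theorem for the bases of shifted dyadic cubes: near
   [exceptional_set a e] the function [(a + e - f)^+] has small integral, but its
   averages over the shifted cubes are at least [e]. *)
Lemma exceptional_set_null a e : 0 < e -> mu (exceptional_set a e) = 0%E.
Proof.
move=> e0; set F := exceptional_set a e.
have mF : measurable (F : set LV) := measurable_exceptional_set a e.
have FQ : (mu F <= mu (dyadic_set root))%E.
  by apply: le_measure; rewrite ?inE//; [exact: measurable_dyadic_set|move=> x []].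
have Foo : (mu F < +oo)%E.
  by rewrite (le_lt_trans FQ)// [ltLHS]lebesgue_measure_dyadic_set ltry.
have Ffin : mu F \is a fin_num by rewrite ge0_fin_numE.
pose phi (x : LV) := Num.max (a + e - f x) 0.
have phi0 x : 0 <= phi x by rewrite le_max lexx orbT.
have mphi : measurable_fun [set: LV] phi.
  apply: measurable_maxr; last exact: measurable_cst.
  by apply: measurable_funB; [exact: measurable_cst|exact: locf.1].
have cB : compact B.
  by apply: compactU; [apply: compactU|]; exact: compact_cube_set.
have mB : measurable (B : set LV).
  by apply: measurableU; [apply: measurableU|]; exact: measurable_cube_set.
(* Cutting off to [B] makes the function integrable on the whole space, so absolute continuity of
   its integral applies. *)
pose psi : LV -> R := phi \_ B.
have psi0 x : 0 <= psi x by rewrite /psi patchE; case: ifP.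
have ipsi : mu.-integrable [set: LV] (EFin \o psi).
  have intNf : mu.-integrable (B : set LV) (EFin \o (fun x => - f x)).
    by have /integrableN := locally_integrable_compact locf cB.
  have Boo : (mu B < +oo)%E.
    have Qoo Q : (mu (cube_set Q) < +oo)%E by rewrite [ltLHS]lebesgue_measure_cube_set ltry.
    have mQ Q : measurable (cube_set Q : set LV) := measurable_cube_set Q.
    have Uoo (X Y : set LV) : measurable X -> measurable Y ->
        (mu X < +oo)%E -> (mu Y < +oo)%E -> (mu (X `|` Y) < +oo)%E.
      move=> mX mY Xoo Yoo.
      exact: le_lt_trans (measureU2 mu mX mY) (lte_add_pinfty Xoo Yoo).
    by apply: (Uoo _ _) => //; [exact: measurableU|exact: (Uoo _ _)].
  have /(integrable_mkcond _ mB) := integrable_positive_part (- (a + e)) mB Boo intNf.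
  rewrite /psi -restrict_EFin; congr integrable; congr (_ \_ _).
  by apply/funext => x /=; rewrite /phi opprK addrC.
have [//|v0] := eqVneq (mu F) 0%E.
have v0' : 0 < fine (mu F) by rewrite fine_gt0// lt0e v0 measure_ge0 Foo.
(* The covering will give [e |F|] at most 3 times the integral of [psi] over the difference of [U]
   and [F]; keeping that integral below [e |F| / 6] contradicts [|F| > 0]. *)
have eta0 : 0 < e * fine (mu F) / 6 by rewrite !mulr_gt0.
have [d [d0 dP]] := integral_normr_continuous ipsi eta0.
have d20 : 0 < d / 2 by rewrite divr_gt0.
have [U [mU FU muU Uball]] := outer_regular d20 Foo.
have UFd : (mu (U `\` F) < d%:E)%E.
  rewrite measureD//; last by rewrite (le_lt_trans muU)// -(fineK Ffin) -EFinD ltry.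
  have -> : U `&` F = F by exact/setIidr.
  apply: (@le_lt_trans _ _ (d / 2)%:E); first by rewrite leeBlDl.
  by rewrite lte_fin; lra.
have {dP} := dP _ (measurableD mU mF) UFd.
pose I : set (dyadic_index n) := [set q | [/\ dyadic_set q `<=` dyadic_set root,
  dyadic_set q `&` F !=set0 & dyadic_set (fwd (fwd q)) `<=` U]].
(* A small enough cube around a point of [F] has its second translate within the ball contained in
   [U]. *)
have FI : F `<=` \bigcup_(q in I) dyadic_set q.
  move=> x Fx; have [r r0 rU] := Uball _ Fx.
  have [k kr] := exists_small_dyadic r0.
  have qx := dyadic_set_index Q0 k x.
  exists (k, index_at Q0 k x) => //; split.
  - by apply: (dyadic_nested _ qx) => //; case: Fx.
  - by exists x.
  - by move=> y /(dyadic_shift_dist qx) xy; apply: rU => i; exact: le_trans (xy i) kr.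
have : (e%:E * mu (\bigcup_(q in I) dyadic_set q) <=
    3%:E * \int[mu]_(x in U) (psi x)%:E)%E.
  apply: (@shifted_covering _ _ Q0 (fun x => (psi x)%:E)) => //.
  - exact: measurable_int ipsi.
  - exact: ltW.
  - by move=> q [].
  - move=> q [qr [x [qx Fx]] _].
    have qa : shifted_average q <= a.
      rewrite leNgt; apply/negP => aq; case: Fx => _ _; apply.
      by exists q.
    rewrite (_ : \int[mu]_(x in _) _ = \int[mu]_(x in dyadic_set (fwd (fwd q))) (phi x)%:E)%E; last first.
      apply: eq_integral => y /set_mem qy.
      by rewrite /psi patchE mem_set//; exact: shifted_subcube_root qy.
    apply: le_trans (le_average_negative_part _ _).
    rewrite lebesgue_measure_dyadic_set -EFinM lee_fin.
    apply: ler_wpM2r; first exact: exprn_ge0 (ltW (dyadic_side_gt0 Q0 q.1)).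
    by rewrite -/(shifted_average q); lra.
(* On [F] one has [f > a + e], so [psi] vanishes there and only the small set outside [F]
   contributes. *)
have -> : (\int[mu]_(x in U) (psi x)%:E)%E = (\int[mu]_(x in U `\` F) (psi x)%:E)%E.
  rewrite [LHS]integral_mkcond [RHS]integral_mkcond; apply: eq_integral => x _.
  rewrite !patchE; have [Fx|Fx] := pselect (F x); last first.
    by congr (if _ then _ else _); apply/idP/idP; rewrite !inE => // -[].
  rewrite (@memNset _ (U `\` F)) => [|[]//]; case: ifP => // _; congr EFin.
  rewrite /psi patchE; case: ifP => // _.
  by apply/max_idPr; case: Fx => _ /ltW; rewrite subr_le0.
have psifin : (\int[mu]_(x in U `\` F) (psi x)%:E)%E \is a fin_num.
  apply: integrable_fin_num; first exact: measurableD.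
  by apply: integrableS ipsi => //; exact: measurableD.
under eq_Rintegral do rewrite ger0_norm//.
rewrite /Rintegral -(fineK psifin) => le1 lt1.
have le2 : (e%:E * mu F <= e%:E * mu (\bigcup_(q in I) dyadic_set q))%E.
  apply: lee_wpmul2l; first by rewrite lee_fin ltW.
  apply: le_measure; rewrite ?inE//.
  by apply: bigcup_countable_measurable => q _; exact: measurable_dyadic_set.
have := le_trans le2 le1.
rewrite -(fineK Ffin) -!EFinM lee_fin => le3.
have ev0 : 0 < e * fine (mu F) by rewrite mulr_gt0.
by exfalso; lra.
Qed.

(** The inclusion holds outside the upper faces of [Q0] and the exceptional sets with margins
    [1 / (k + 1)], which are countably many null sets. *)
Lemma superlevel_sub_stopping_set (a : R) :
  (mu [set x | cube_set Q0 x /\ (a < f x)%R] <= mu (stopping_set a))%E.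
Proof.
have [mN N0] := cube_boundary_null Q0.
set N := \bigcup_i _ in mN N0.
pose E (k : nat) : set LV := exceptional_set a k.+1%:R^-1.
have mE k : measurable (E k) by exact: measurable_exceptional_set.
have mU : measurable (\bigcup_k E k) by exact: bigcup_measurable.
have mS := measurable_stopping_set Q0 f a.
have U0 : (mu (\bigcup_k E k) <= 0)%E.
  apply: (le_trans (measure_sigma_subadditive _ mE mU (@subset_refl _ _))).
  by rewrite eseries0// => k _ _; apply: exceptional_set_null; rewrite invr_gt0.
apply: (@le_trans _ _ (mu (stopping_set a `|` N `|` \bigcup_k E k))).
  apply: le_lebesgue_outer_rV => x [Qx ax].
  have [Nx|Nx] := pselect (N x); first by left; right.
  have [Sx|Sx] := pselect (stopping_set a x); first by left; left.
  right; have /ltr_add_invr[k] := ax.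
  move=> xk; exists k => //; split => //.
  by rewrite dyadic_set_root half_open_cubeE; split.
apply: (le_trans (measureU2 _ _ _)) => //; first exact: measurableU.
apply: (le_trans (leeD (measureU2 _ _ _) U0)) => //.
by rewrite [X in (_ + X + _)%E]N0 !adde0.
Qed.

End differentiation.

(** * The weak-type estimate *)

(** Iterating at [l / 2], [l / 4] and so on sums a geometric series to at most [2 K]. The a priori
    bound controls the remainder by [2^-k l^p X], which tends to 0. *)
Lemma le_of_doubling_contraction (R : realType) (p X K : R) (g : R -> R) :
  0 <= p -> 0 <= X -> 0 <= K ->
  (forall l, 0 < l -> g (2 * l) <= g l / 2 + K) ->
  (forall l, 0 < l -> g l <= l `^ p * X) ->
  forall l, 0 < l -> g l <= 2 * K.
Proof.
move=> p0 X0 K0 contr gX.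
have main k l : 0 < l -> g l <= 2 * K + (2 ^+ k)^-1 * (l `^ p * X).
  elim: k l => [|k IH] l l0.
    by rewrite expr0 invr1 mul1r (le_trans (gX _ l0))// lerDr mulr_ge0.
  have l20 : 0 < l / 2 by rewrite divr_gt0.
  (* This crude bound is enough: the decay in [k] comes from the factor [1/2] of the contraction. *)
  have le_l : (l / 2) `^ p <= l `^ p.
    by apply: ge0_ler_powR => //; rewrite ?nnegrE; lra.
  have := contr _ l20; rewrite mulrCA divff// mulr1 => /le_trans; apply.
  have := IH _ l20; have := ler_wpM2r X0 le_l.
  rewrite exprS invfM; have k0 : 0 <= (2 ^+ k)^-1 :> R by rewrite invr_ge0 exprn_ge0.
  by move=> /(ler_wpM2l k0); lra.
move=> l l0; apply/ler_addgt0Pr => e e0.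
have Y0 : 0 <= l `^ p * X by rewrite mulr_ge0 ?powR_ge0.
have [|k Yk] := exp2_archimedean (x := l `^ p * X / e); first by rewrite divr_ge0// ltW.
apply: (le_trans (main k _ l0)); rewrite lerD2l ler_pdivrMl ?exprn_gt0//.
by move: Yk; rewrite ltr_pdivrMr// => /ltW.
Qed.

Theorem mainTheorem1 (R : realType) (n : nat) (p : R) (p_gt1 : 1 < p) :
  exists C : R,
    forall f : 'rV[R]_n.+1 -> R, JNp_plus p f ->
    forall (Q0 : cube R n) (lambda : R), 0 < lambda ->
    (lebesgue_measure_rV
       [set x | cube_set Q0 x /\
          (lambda <
             Num.max (f x - average (cube_set (forward (forward Q0))) f) 0)%R]
     <= C%:E * (Kplus p f * (lambda^-1)%:E) `^ p)%E.
Proof.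
have p0 : 0 < p by exact: lt_trans p_gt1.
pose D : R := 2 ^+ n.+1; have D0 : 0 < D by rewrite exprn_gt0.
pose T : R := 2 `^ p; have T0 : 0 < T by rewrite powR_gt0.
(* This choice turns the coefficient of [mu (stopping_set a)] in [good_lambda] into [1/2]
   after multiplication by [2^p a^(p-1)]. *)
pose eta := (12 * T * D)^-1.
have eta0 : 0 < eta by rewrite invr_gt0 !mulr_gt0.
pose C0 := 6 * T * eta `^ (1 - p).
have C00 : 0 <= C0 by rewrite !mulr_ge0 ?powR_ge0// ltW.
exists (2 * C0) => f [locf Koo] Q0 l l0.
set c := average _ f.
have cE : c = shifted_average Q0 f (dyadic_root n).
  by rewrite /c /shifted_average -!forward_dyadic dyadic_rootE.
have S0 : (0 <= ereal_sup (JNp_plus_sums p f))%E.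
  (* The empty family contributes the sum 0. *)
  apply: ereal_sup_ubound; exists set0, (fun=> Q0).
  by rewrite !esum_set0; split => // i j [].
have Sfin : ereal_sup (JNp_plus_sums p f) \is a fin_num.
  rewrite ge0_fin_numE// ltey; apply/eqP => Soo.
  move: Koo; rewrite /Kplus Soo poweRyr ?ltxx// invr_eq0 gt_eqF//.
set S := ereal_sup _ in S0 Sfin.
pose M := fine S; have SM : S = M%:E by rewrite fineK.
have M0 : 0 <= M by rewrite fine_ge0.
pose E a := stopping_set Q0 f (c + a).
have E0 a : (lebesgue_measure_rV (E a) <= (side Q0 ^+ n.+1)%:E)%E.
  rewrite -lebesgue_measure_half_open_cube; apply: le_lebesgue_outer_rV.
  by move=> x [q [q0 _] qx]; rewrite -dyadic_set_root; exact: q0.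
have Efin a : lebesgue_measure_rV (E a) \is a fin_num.
  by rewrite ge0_fin_numE ?measure_ge0// (le_lt_trans (E0 a)) ?ltry.
pose m a := fine (lebesgue_measure_rV (E a)).
have mE a : lebesgue_measure_rV (E a) = (m a)%:E by rewrite fineK.
have step a : 0 < a -> (2 * a) `^ p * m (2 * a) <= a `^ p * m a / 2 + C0 * M.
  move=> a0; have ea0 : 0 < eta * a by rewrite mulr_gt0.
  have ca : shifted_average Q0 f (dyadic_root n) <= c + a by rewrite -cE lerDl ltW.
  have ab : c + a <= c + 2 * a by rewrite lerD2l; lra.
  (* Levels [c + a] and [c + 2 a] with [s = eta a]: the level gap [a] makes both sides homogeneous
     in [a]. *)
  have := good_lambda locf p_gt1 ca ab ea0.
  rewrite -/S SM [X in (_ * X <= _)%E]mE [X in (_ <= _ * X + _)%E]mE -!EFinM -EFinD lee_fin.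
  rewrite (_ : c + 2 * a - (c + a) = a); last by ring.
  rewrite !powRM ?(ltW a0) ?(ltW eta0)//.
  have -> : a `^ (1 - p) = (a `^ (p - 1))^-1 by rewrite -powRN opprB.
  have L0 : 0 < a `^ (p - 1) by rewrite powR_gt0.
  (* Writing [a^p] as [a * a^(p-1)] and abstracting [a^(p-1)] as [L] leaves a rational identity
     after multiplication by [T L]. *)
  rewrite -(mulr_powRB1 (ltW a0) p0) -/T /C0 -/D.
  move: (a `^ (p - 1)) L0 => L L0 H.
  have TL0 : 0 <= T * L by rewrite mulr_ge0// ltW.
  have := ler_wpM2l TL0 H.
  rewrite (_ : T * L * (a * m (2 * a)) = T * (a * L) * m (2 * a)); last by ring.
  move=> /le_trans; apply.
  rewrite le_eqVlt; apply/orP; left; apply/eqP.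
  rewrite /eta; field; rewrite ?gt_eqF//.
have bnd a : 0 < a -> a `^ p * m a <= a `^ p * side Q0 ^+ n.+1.
  move=> _; apply: ler_wpM2l; first exact: powR_ge0.
  by rewrite -lee_fin -mE.
have V0 : 0 <= side Q0 ^+ n.+1 by rewrite exprn_ge0// ltW// side_gt0.
have K0 : 0 <= C0 * M by rewrite mulr_ge0.
have fin := le_of_doubling_contraction (ltW p0) V0 K0 step bnd l0.
apply: (@le_trans _ _ (lebesgue_measure_rV [set x | cube_set Q0 x /\ (c + l < f x)%R])).
  (* As [l > 0], the positive part exceeds [l] only where [f - c] does. *)
  apply: le_lebesgue_outer_rV => x [Qx]; rewrite lt_max => /orP[|]; last by rewrite ltNge ltW.
  by move=> lf; split => //; rewrite -ltrBrDl.
apply: (le_trans (superlevel_sub_stopping_set Q0 locf _)).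
have KE : Kplus p f = (M `^ p^-1)%:E by rewrite /Kplus -/S SM.
have -> : ((Kplus p f * (l^-1)%:E) `^ p = ((M `^ p^-1 * l^-1) `^ p)%:E)%E by rewrite KE.
rewrite -/(E l) mE -EFinM lee_fin.
(* The right side becomes [2 C0 M / l^p], so the claim is the bound [fin] divided by [l^p]. *)
have li : l^-1 `^ p = (l `^ p)^-1 by rewrite -powR_inv1 ?ltW// powRAC powR_inv1 ?powR_ge0.
rewrite powRM ?powR_ge0 ?invr_ge0 ?(ltW l0)// -powRrM mulVf ?gt_eqF// powRr1// li.
by rewrite mulrA ler_pdivlMr ?powR_gt0// mulrC -[leRHS]mulrA.
Qed.
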